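(* Let $\mathcal{C}_0$ denote the algebra of convolution-dominated matrices over $\mathbb{Z}^d$ and let $r>0$. The approximation space $\mathcal{E}^\infty_r(\mathcal{C}_0)$ is equal to the Hölder-Zygmund space $\Lambda_r(\mathcal{C}_0)$. It consists of all matrices $A$ over $\mathbb{Z}^d$ for which there is a constant $C$ such that $\|\hat A(0)\|_{\ell^2\to\ell^2}<\infty$ and, for all integers $k\ge0$, $$2^{rk}\sum_{2^k\le|l|<2^{k+1}}\|\hat A(l)\|_{\ell^2\to\ell^2}=2^{rk}\sum_{2^k\le|l|<2^{k+1}}\ \sup_{m\in\mathbb{Z}^d}|A(m,m-l)|\le C .$$
   Context: $|x|$ denotes the $1$-norm on $\mathbb{R}^d$. For a complex matrix $A$ over $\mathbb{Z}^d$ and $m\in\mathbb{Z}^d$, the $m$-th side diagonal $\hat A(m)$ is the matrix with $\hat A(m)(k,l)=A(k,l)$ if $k-l=m$ and $0$ otherwise. $\mathcal{C}_0$ is the Banach algebra (under matrix multiplication) of all matrices with $\|A\|_{\mathcal{C}_0}=\sum_{k\in\mathbb{Z}^d}\sup_{l\in\mathbb{Z}^d}|A(l,l-k)|<\infty$. Banach spaces with equivalent norms are considered equal. Approximation space: let $\mathcal{T}_N=\{A\in\mathcal{C}_0:A=\sum_{|k|<N}\hat A(k)\}$, $N\in\mathbb{N}_0$ (so $\mathcal{T}_0=\{0\}$), $E_N(A)=\inf_{B\in\mathcal{T}_N}\|A-B\|_{\mathcal{C}_0}$; $\mathcal{E}^\infty_r(\mathcal{C}_0)$ is the space of $A\in\mathcal{C}_0$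 with $\sup_{N\ge0}E_N(A)(N+1)^r<\infty$. Hölder-Zygmund space: the automorphism group on $\mathcal{A}=\mathcal{C}_0$ is $\chi_t(A)(k,l)=e^{2\pi i(k-l)\cdot t}A(k,l)$, $t\in\mathbb{R}^d$. $C(\mathcal{A})=\{A\in\mathcal{A}:\|\chi_t(A)-A\|_{\mathcal{A}}\to0\text{ as }t\to0\}$. The canonical generators are $\delta_j(A)=\lim_{h\to0}h^{-1}(\chi_{he_j}(A)-A)$ (norm limit, where it exists), $\delta^\alpha=\delta_1^{\alpha_1}\cdots\delta_d^{\alpha_d}$, and $C^k(\mathcal{A})$ is the set of $A\in C(\mathcal{A})$ for which $\delta^\alpha(A)$ is defined and in $C(\mathcal{A})$ for all $|\alpha|\le k$, with norm $\|A\|_{C^k(\mathcal{A})}=\sum_{|\alpha|\le k}\frac1{\alpha!}\|\delta^\alpha A\|_{\mathcal{A}}$. With $\Delta_tA=\chi_t(A)-A$, $\Delta_t^2=\Delta_t\Delta_t$ and $|A|_{\Lambda_\eta}=\sup_{t\ne0}|t|^{-\eta}\|\Delta_t^2A\|_{\mathcal{A}}$ for $0<\eta\le1$, the space $\Lambda_r(\mathcal{A})$ for $r=k+\eta$, $k\in\mathbb{N}_0$, $0<\eta\le1$, consists of all $A\in C^k(\mathcal{A})$ with $\|A\|_{\Lambda_r(\mathcal{A})}=\|A\|_{C^k(\mathcal{A})}+\sum_{|\alpha|=k}|\delta^\alpha(A)|_{\Lambda_\eta}<\infty$. *)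

(* Defs.v *)
From mathcomp Require Import all_boot all_order all_algebra.
From mathcomp Require Export complex.
From mathcomp Require Export all_classical all_reals all_analysis.
From mathcomp Require Export summability.

Set Implicit Arguments.
Unset Strict Implicit.
Unset Printing Implicit Defensive.

Import Order.TTheory GRing.Theory Num.Theory.
Import numFieldNormedType.Exports.
Import ComplexField.Normc.

Local Open Scope classical_set_scope.
Local Open Scope ring_scope.
Local Open Scope ereal_scope.

(* Elements of Z^d are integer row vectors.  An infinite complex matrix over
   Z^d is a function of two indices, with the pointwise additive structure
   of function types.  The complex numbers are R[i] for R : realType, with
   modulus normc : R[i] -> R.  Norms take values in \bar R and are defined on
   all matrices, so that a matrix belongs to a space iff its norm is finite
   (and, for smoothness spaces, iff the relevant derivatives exist). *)
Notation zmat R d := ('rV[int]_d -> 'rV[int]_d -> R[i]).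

Definition znorm1 d (k : 'rV[int]_d) : nat := (\sum_i `|k ord0 i|)%N.

Definition rnorm1 (R : realType) d (t : 'rV[R]_d) : R :=
  (\sum_i `|t ord0 i|)%R.

Definition side_diag (R : realType) d (m : 'rV[int]_d) (A : zmat R d)
    : zmat R d :=
  fun k l => if (k - l)%R == m then A k l else 0%R.

Definition diag_sup (R : realType) d (A : zmat R d) (k : 'rV[int]_d) : \bar R :=
  ereal_sup [set (normc (A l (l - k)%R))%:E | l in [set: 'rV[int]_d]].

Definition C0norm (R : realType) d (A : zmat R d) : \bar R :=
  \esum_(k in [set: 'rV[int]_d]) diag_sup A k.

Definition C0 (R : realType) d : set (zmat R d) :=
  [set A | C0norm A < +oo].

Definition l2norm (R : realType) d (x : 'rV[int]_d -> R[i]) : \bar R :=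
  poweR (\esum_(k in [set: 'rV[int]_d]) ((normc (x k)) ^+ 2)%:E) 2^-1.

(* y = A x: each series \sum_l A(k,l) x(l) converges unconditionally to y(k),
   i.e. along the net of finite subsets of Z^d. *)
Definition zmat_apply (R : realType) d (A : zmat R d)
    (x y : 'rV[int]_d -> R[i]) : Prop :=
  forall k, (normc (partial_sum (fun l => A k l * x l) F - y k)%R)
              @[F --> totally] --> (0%R : R).

(* Operator norm of A on l^2: the least bound, +oo when there is none (in
   particular when A x is undefined for some x in l^2). *)
Definition l2opnorm (R : realType) d (A : zmat R d) : \bar R :=
  ereal_inf [set c%:E | c in [set c : R | (0 <= c)%R /\
    forall x, l2norm x < +oo ->
      exists2 y, zmat_apply A x y & l2norm y <= c%:E * l2norm x]].

Definition banded (R : realType) d (N : nat) : set (zmat R d) :=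
  [set A | C0 A /\
    A = (\sum_(k \in [set k | (znorm1 k < N)%N]) side_diag k A)%R].

Definition approx_error (R : realType) d (N : nat) (A : zmat R d) : \bar R :=
  ereal_inf [set C0norm (A - B)%R | B in @banded R d N].

Definition approx_norm (R : realType) d (r : R) (A : zmat R d) : \bar R :=
  ereal_sup [set approx_error N A * (N.+1%:R `^ r)%:E | N in [set: nat]].

Definition approx_space (R : realType) d (r : R) : set (zmat R d) :=
  [set A | C0 A /\ approx_norm r A < +oo].

Definition expi (R : realType) (theta : R) : R[i] :=
  (cos theta +i* sin theta)%C.

Definition zdot (R : realType) d (k : 'rV[int]_d) (t : 'rV[R]_d) : R :=
  (\sum_i (k ord0 i)%:~R * t ord0 i)%R.

Definition chi (R : realType) d (t : 'rV[R]_d) (A : zmat R d) : zmat R d :=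
  fun k l => (expi (2 * pi * zdot (k - l) t) * A k l)%R.

Definition chi_continuous (R : realType) d : set (zmat R d) :=
  [set A | C0 A /\
    C0norm (chi t A - A)%R @[t --> (0%R : 'rV[R]_d)] --> (0 : \bar R)].

(* The generators are partial operators, hence given by their graphs:
   B = delta_j(A), the limit being taken in the norm of C0. *)
Definition is_delta (R : realType) d (j : 'I_d) (A B : zmat R d) : Prop :=
  [/\ C0 A, C0 B &
    C0norm (fun k l => ((h^-1)%:C%C
                        * (chi (h *: delta_mx ord0 j) A - A) k l - B k l)%R)
      @[h --> (0%R : R)^'] --> (0 : \bar R)].

(* Graph of the composite delta_(s_0) delta_(s_1) ... delta_(s_n), the last
   generator being applied first. *)
Fixpoint is_delta_seq (R : realType) d (s : seq 'I_d) (A B : zmat R d) : Prop :=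
  if s is j :: s' then exists2 A', is_delta_seq s' A A' & is_delta j A' B
  else A = B.

(* The entries of a multi-index of degree at most k are at most k, so this
   finite type contains all multi-indices of degree at most k. *)
Definition mindex d (k : nat) := {ffun 'I_d -> 'I_k.+1}.

Definition is_delta_pow (R : realType) d k (alpha : mindex d k)
    (A B : zmat R d) : Prop :=
  is_delta_seq (flatten [seq nseq (alpha j) j | j <- enum 'I_d]) A B.

(* delta^alpha A, with the junk value 0 outside the domain of delta^alpha *)
Definition delta_pow (R : realType) d k (alpha : mindex d k) (A : zmat R d)
    : zmat R d :=
  xget 0%R [set B | is_delta_pow alpha A B].

Definition mdegree d k (alpha : mindex d k) : nat := (\sum_j alpha j)%N.

Definition mfact d k (alpha : mindex d k) : nat := (\prod_j (alpha j)`!)%N.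

Definition Ck (R : realType) d (k : nat) : set (zmat R d) :=
  [set A | chi_continuous A /\
    forall alpha : mindex d k, (mdegree alpha <= k)%N ->
      exists2 B, is_delta_pow alpha A B & chi_continuous B].

Definition Cknorm (R : realType) d (k : nat) (A : zmat R d) : \bar R :=
  \sum_(alpha : mindex d k | (mdegree alpha <= k)%N)
    ((mfact alpha)%:R^-1)%:E * C0norm (delta_pow alpha A).

Definition chi_diff (R : realType) d (t : 'rV[R]_d) (A : zmat R d) : zmat R d :=
  (chi t A - A)%R.

Definition zygmund_seminorm (R : realType) d (eta : R) (A : zmat R d)
    : \bar R :=
  ereal_sup [set (rnorm1 t `^ (- eta))%:E * C0norm (chi_diff t (chi_diff t A))
            | t in [set t : 'rV[R]_d | t != 0%R]].

(* Lambda_(k + eta)(C0), for 0 < eta <= 1 *)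
Definition hz_norm (R : realType) d (k : nat) (eta : R) (A : zmat R d)
    : \bar R :=
  Cknorm k A + \sum_(alpha : mindex d k | mdegree alpha == k)
                 zygmund_seminorm eta (delta_pow alpha A).

Definition hz_space (R : realType) d (k : nat) (eta : R) : set (zmat R d) :=
  [set A | Ck k A /\ hz_norm k eta A < +oo].

Definition dyadic_shell d (k : nat) : set 'rV[int]_d :=
  [set l | (2 ^ k <= znorm1 l < 2 ^ k.+1)%N].

(* Main.v *)
(* Conjugating by characters acts on a matrix diagonal by diagonal, so with
   [a m] the supremum of the moduli on the [m]-th side diagonal every norm in
   the theorem is a weighted sum of the numbers [a m].  The approximation error
   is the tail of [\sum_m a m], and all spaces are compared with the dyadic
   condition [\sum_(2^i <= |m| < 2^(i+1)) a m <= K 2^(- r i)].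

   From the dyadic condition to the Zygmund norm one sums over shells the bound
   [|e^(i x) - 1|^2 <= 4 min(1, x^2)].  Conversely, on the [i]-th shell some
   coordinate satisfies [|m_j| >= 2^i / d]; for the step [h = 2^(- i - 2)] in
   direction [j] the angle [2 pi h m_j] has modulus in [[pi / (2 d), pi]],
   where [|e^(i x) - 1|^2 = 2 - 2 cos x] is bounded below, so the second
   differences of [delta_j^k A] control the shell. *)

Require Import Defs.
From mathcomp Require Import all_boot all_order all_algebra.
From mathcomp Require Import complex finmap.
From mathcomp Require Import all_classical all_reals all_analysis.
From mathcomp Require Import ring lra zify.

Set Implicit Arguments.
Unset Strict Implicit.
Unset Printing Implicit Defensive.

Import Order.TTheory GRing.Theory Num.Theory.
Import numFieldNormedType.Exports.
Import ComplexField.Normc.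

Local Open Scope classical_set_scope.
Local Open Scope ring_scope.
Local Open Scope ereal_scope.

(** * Elementary bounds for [expi] *)

Lemma MVT_everywhere (R : realType) (f df : R -> R)
    (hf : forall x, is_derive x (1%R : R) f (df x)) (a b : R) : (a <= b)%R ->
  exists2 c, c \in `[a, b]%R & (f b - f a = df c * (b - a))%R.
Proof.
move=> ab; apply: (@MVT_segment R f df a b ab).
apply: continuous_subspaceT => z.
by apply/differentiable_continuous/derivable1_diffP; case: (hf z).
Qed.

Lemma dist_le_of_derivative_le1 (R : realType) (f df : R -> R)
    (hf : forall x, is_derive x (1%R : R) f (df x))
    (df1 : forall x, (`|df x| <= 1)%R) (x y : R) :
  (`|f x - f y| <= `|x - y|)%R.
Proof.
have le_case a b : (a <= b)%R -> (`|f b - f a| <= `|b - a|)%R.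
  by move=> ab; have [c _ ->] := MVT_everywhere hf ab; rewrite normrM ler_piMl.
by have [/le_case|/ltW/le_case//] := leP y x; rewrite // distrC [leRHS]distrC.
Qed.

Lemma sin_norm_le (R : realType) (x : R) : (`|sin x| <= `|x|)%R.
Proof.
have := @dist_le_of_derivative_le1 R sin cos (@is_derive_sin R) (@cos_max R) x 0.
by rewrite sin0 !subr0.
Qed.

Lemma cos_sub1_norm_le (R : realType) (x : R) : (`|cos x - 1| <= `|x|)%R.
Proof.
have := @dist_le_of_derivative_le1 R cos (fun y => - sin y)%R (@is_derive_cos R) _ x 0.
by rewrite cos0 subr0; apply => y; rewrite normrN sin_max.
Qed.

Lemma normcE_sqr (R : realType) (a b : R) :
  (normc (a +i* b)%C ^+ 2 = a ^+ 2 + b ^+ 2)%R.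
Proof. by rewrite /normc sqr_sqrtr// addr_ge0// sqr_ge0. Qed.

Lemma normc_ge0 (R : realType) (z : R[i]) : (0 <= normc z)%R.
Proof. by case: z => a b; exact: sqrtr_ge0. Qed.

Lemma normc_le_ReIm (R : realType) (a b : R) :
  (normc (a +i* b)%C <= `|a| + `|b|)%R.
Proof.
rewrite -(ler_pXn2r (n:=2))// ?nnegrE ?normc_ge0 ?addr_ge0//.
rewrite normcE_sqr -(real_normK (num_real a)) -(real_normK (num_real b)).
by rewrite sqrrD lerD2r lerDl mulrn_wge0// mulr_ge0.
Qed.

Lemma normc_triangle (R : realType) (x y : R[i]) :
  (normc (x + y) <= normc x + normc y)%R.
Proof. exact: le_normcD. Qed.

Lemma normc_opp (R : realType) (z : R[i]) : normc (- z)%R = normc z.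
Proof. by case: z => a b; rewrite /normc /= !sqrrN. Qed.

Lemma normc_zero (R : realType) : normc (0 : R[i])%R = 0%R.
Proof. exact: normc0. Qed.

Lemma normc_one (R : realType) : normc (1 : R[i])%R = 1%R.
Proof. exact: normc1. Qed.

Lemma normc_real (R : realType) (a : R) : normc (a%:C)%C = `|a|%R.
Proof. by rewrite /normc /= expr0n/= addr0 sqrtr_sqr. Qed.

Lemma normc_i (R : realType) : normc ('i%C : R[i]) = 1%R.
Proof. by rewrite /normc /= expr0n/= add0r expr1n sqrtr1. Qed.

Lemma normc_prod (R : realType) (I : Type) (s : seq I) (f : I -> R[i]) :
  normc (\prod_(i <- s) f i)%R = (\prod_(i <- s) normc (f i))%R.
Proof. by rewrite (big_morph (@normc R) (@normcM R) (@normc1 R)). Qed.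

Lemma expi_sub1_sqr (R : realType) (x : R) :
  (normc (expi x - 1) ^+ 2 = 2 - 2 * cos x)%R.
Proof.
rewrite /expi [X in normc X](_ : _ = ((cos x - 1) +i* sin x)%C)%R; last first.
  by apply/eqP; rewrite eq_complex/= subr0 !eqxx.
rewrite normcE_sqr; have := cos2Dsin2 x; move: (cos x) (sin x) => c s; lra.
Qed.

Lemma expi_sub1_le2 (R : realType) (x : R) : (normc (expi x - 1) <= 2)%R.
Proof.
rewrite -(ler_pXn2r (n:=2))// ?nnegrE ?normc_ge0// expi_sub1_sqr.
have := cos_geN1 x; move: (cos x) => c; lra.
Qed.

Lemma expi_sub1_le (R : realType) (x : R) : (normc (expi x - 1) <= 2 * `|x|)%R.
Proof.
rewrite /expi [X in normc X](_ : _ = ((cos x - 1) +i* sin x)%C)%R; last first.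
  by apply/eqP; rewrite eq_complex/= subr0 !eqxx.
apply: le_trans (normc_le_ReIm _ _) _.
by rewrite mulr_natl mulr2n lerD// ?cos_sub1_norm_le ?sin_norm_le.
Qed.

Lemma sin_sub_norm_le (R : realType) (x : R) : (`|sin x - x| <= x ^+ 2)%R.
Proof.
pose df y : R := (cos y - 1)%R.
pose f (y : R) := (sin y - y)%R.
have hf y : is_derive y (1%R : R) f (df y).
  by rewrite /f /df; apply: is_deriveB.
have le_case := MVT_everywhere hf.
have f0 : f 0%R = 0%R by rewrite /f sin0 subr0.
suff [c cx fx] : exists2 c : R, (`|c| <= `|x|)%R & (f x = df c * x)%R.
  rewrite -/(f x) fx normrM -real_normK ?num_real// expr2 ler_wpM2r//.
  exact: le_trans (cos_sub1_norm_le c) cx.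
have [x0|/ltW x0] := leP 0%R x.
  have [c] := le_case _ _ x0; rewrite in_itv/= f0 !subr0 => /andP[c0 cx] ->.
  by exists c => //; rewrite !ger0_norm.
have [c] := le_case _ _ x0; rewrite in_itv/= f0 !sub0r mulrN => /andP[xc c0].
by move/oppr_inj => ->; exists c => //; rewrite !ler0_norm// lerN2.
Qed.

Lemma expi_taylor2 (R : realType) (x : R) :
  (normc (expi x - 1 - x%:C%C * 'i%C) <= 2 * x ^+ 2)%R.
Proof.
rewrite /expi [X in normc X](_ : _ = ((cos x - 1) +i* (sin x - x))%C)%R; last first.
  by apply/eqP; rewrite eq_complex/= !mul0r !mulr0 !subr0 !addr0 !mulr1 !eqxx.
apply: le_trans (normc_le_ReIm _ _) _.
rewrite mulr_natl mulr2n lerD ?sin_sub_norm_le//.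
rewrite ler0_norm ?subr_le0 ?cos_le1// opprB.
have [c cx /eqP] := MVT_everywhere (@is_derive_cos R) (normr_ge0 x).
rewrite cos0 cos_norm subr0 => /eqP E.
have -> : (1 - cos x = sin c * `|x|)%R by rewrite -[LHS]opprB E mulNr opprK.
rewrite -real_normK ?num_real// expr2 ler_wpM2r//.
move: cx; rewrite in_itv/= => /andP[c0 cx].
by rewrite (le_trans (ler_norm _))// (le_trans (sin_norm_le _))// ger0_norm.
Qed.

Lemma expi0 (R : realType) : expi 0 = 1%R :> R[i].
Proof. by rewrite /expi sin0 cos0. Qed.

Lemma cos_le_between (R : realType) (a x : R) :
  (0 <= a)%R -> (a <= `|x|)%R -> (`|x| <= pi)%R -> (cos x <= cos a)%R.
Proof.
move=> a0 ax xpi; rewrite -(cos_norm x).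
have I y : (0 <= y)%R -> (y <= pi)%R -> y \in `[0%R, pi : R]%R.
  by move=> y0 ypi; rewrite in_itv/= y0.
move: ax; rewrite le_eqVlt => /predU1P[->//|ax].
by rewrite ltW// ltr_cos// I// ltW// (lt_le_trans ax).
Qed.

(** * Weighted sums over side diagonals *)

Lemma esumZl (R : realType) (T : choiceType) (I : set T) (c : R)
    (a : T -> \bar R) : (0 <= c)%R -> (forall i, 0 <= a i) ->
  \esum_(i in I) (c%:E * a i) = c%:E * \esum_(i in I) a i.
Proof.
move=> c0 a0; rewrite /esum -ereal_supZl//; last first.
  by apply/set0P; exists 0, set0; [exact: fsets_set0|rewrite fsbig_set0].
rewrite image_comp; congr ereal_sup; apply: eq_imagel => X _ /=.
by rewrite ge0_mule_fsumr.
Qed.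

Definition multiplier (R : realType) d (f : 'rV[int]_d -> R[i]) (A : zmat R d) :
  zmat R d := fun k l => (f (k - l) * A k l)%R.

Lemma diag_sup_ge0 (R : realType) d (A : zmat R d) m : 0 <= diag_sup A m.
Proof.
apply: le_ereal_sup_tmp; exists (normc (A 0%R (0 - m)%R))%:E; first by exists 0%R.
by rewrite lee_fin normc_ge0.
Qed.

Lemma diag_sup_multiplier (R : realType) d (f : 'rV[int]_d -> R[i])
    (A : zmat R d) m :
  diag_sup (multiplier f A) m = (normc (f m))%:E * diag_sup A m.
Proof.
rewrite /diag_sup -ereal_supZl ?normc_ge0//; last first.
  by apply/set0P; eexists; exists 0%R.
congr ereal_sup; rewrite image_comp; apply: eq_imagel => l _ /=.
by rewrite /multiplier subKr normcM EFinM.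
Qed.

Lemma C0norm_multiplier (R : realType) d (f : 'rV[int]_d -> R[i]) (A : zmat R d) :
  C0norm (multiplier f A) =
  \esum_(m in [set: 'rV[int]_d]) ((normc (f m))%:E * diag_sup A m).
Proof. by apply: eq_esum => m _; exact: diag_sup_multiplier. Qed.

Lemma entry_le_C0norm (R : realType) d (A : zmat R d) k l :
  (normc (A k l))%:E <= C0norm A.
Proof.
apply: (@le_trans _ _ (diag_sup A (k - l)%R)).
  by apply: ereal_sup_ubound; exists k => //; rewrite subKr.
apply: esum_ge; exists [set (k - l)%R]; last by rewrite fsbig_set1.
by split => //; exact: finite_set1.
Qed.

Lemma C0_diag_sup_fin (R : realType) d (A : zmat R d) m :
  C0 A -> diag_sup A m \is a fin_num.
Proof.
move=> CA; rewrite ge0_fin_numE ?diag_sup_ge0//; apply: le_lt_trans CA.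
apply: esum_ge; exists [set m]; last by rewrite fsbig_set1.
by split => //; exact: finite_set1.
Qed.

Lemma C0norm_ge0 (R : realType) d (A : zmat R d) : 0 <= C0norm A.
Proof. by apply: esum_ge0 => m _; exact: diag_sup_ge0. Qed.

Lemma esum_fset_approx (R : realType) (I : choiceType) (v : I -> R) (e : R) :
  (0 < e)%R -> (forall m, 0 <= v m)%R ->
  \esum_(m in [set: I]) (v m)%:E < +oo ->
  exists2 X : set I, finite_set X & \esum_(m in ~` X) (v m)%:E <= e%:E.
Proof.
move=> e0 v0 vfin.
have v0' m : 0 <= (v m)%:E by rewrite lee_fin.
have fin : \esum_(m in [set: I]) (v m)%:E \is a fin_num.
  by rewrite ge0_fin_numE// esum_ge0.
have [_ [X [finX _] <-] ltX] := ub_ereal_sup_adherent e0 fin.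
exists X => //; move: fin ltX.
rewrite -/(esum [set: I] (EFin \o v)) (esumID X)// !setTI (esum_fset finX)//.
rewrite fsbig_finite//= sumEFin.
set s := (\sum_(i <- _) _)%R; case: (\esum_(i in ~` X) _) => [t| |]//.
by rewrite -EFinD -EFinB lte_fin lee_fin => _ h; lra.
Qed.

Lemma dominated_esum_cvg0 (R : realType) (T : Type) (F : set_system T)
    {FF : ProperFilter F} (I : choiceType) (u : T -> I -> R) (v : I -> R) :
  (\forall t \near F, forall m, 0 <= u t m <= v m)%R ->
  \esum_(m in [set: I]) (v m)%:E < +oo ->
  (forall m, u t m @[t --> F] --> (0 : R)%R) ->
  \esum_(m in [set: I]) (u t m)%:E @[t --> F] --> 0.
Proof.
move=> uv vfin u0.
have v0 m : (0 <= v m)%R.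
  by have [t /(_ m) /andP[/le_trans]] := filter_ex uv; exact.
apply/fine_cvgP; split.
  near=> t; have utv : forall m, (0 <= u t m <= v m)%R by near: t.
  rewrite ge0_fin_numE; last first.
    by apply: esum_ge0 => m _; rewrite lee_fin; case/andP: (utv m).
  apply: le_lt_trans vfin; apply: le_esum => m _.
  by rewrite lee_fin; case/andP: (utv m).
apply/cvgrPdist_le => e e0.
have e2 : (0 < e / 2)%R by rewrite divr_gt0.
have [X finX tailX] := esum_fset_approx e2 v0 vfin.
have sum0 : (\sum_(m <- fset_set X) u t m)%R @[t --> F] --> (0 : R)%R.
  have := @cvg_big _ _ _ 0%R xpredT (@add_continuous R) T F (fset_set X)
    (fun m t => u t m) (fun=> 0%R) _ (fun m _ => u0 m).
  by rewrite big1// => sum0; exact: sum0.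
near=> t; have utv : forall m, (0 <= u t m <= v m)%R by near: t.
have ut0 m : 0 <= (u t m)%:E by rewrite lee_fin; case/andP: (utv m).
have : (`|0 - \sum_(m <- fset_set X) u t m| <= e / 2)%R.
  by near: t; move/cvgrPdist_le: sum0; exact.
rewrite !sub0r !normrN /= => /(le_trans (ler_norm _)) sumX.
rewrite ger0_norm ?fine_ge0 ?esum_ge0// -lee_fin.
have esum_le : \esum_(m in [set: I]) (u t m)%:E <= e%:E.
  rewrite (esumID X)// !setTI [e in e%:E](splitr e) EFinD leeD//.
    by rewrite esum_fset// fsbig_finite//= sumEFin lee_fin.
  apply: le_trans tailX; apply: le_esum => m _.
  by rewrite lee_fin; case/andP: (utv m).
rewrite fineK// ge0_fin_numE ?esum_ge0//.
exact: le_lt_trans esum_le (ltry _).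
Unshelve. all: by end_near. Qed.

Lemma znorm1_eq0 d (m : 'rV[int]_d) : (znorm1 m == 0)%N = (m == 0%R).
Proof.
rewrite /znorm1 sum_nat_eq0; apply/forallP/eqP => [m0|-> i]; last by rewrite mxE.
by apply/rowP => i; rewrite mxE; apply/eqP; rewrite -absz_eq0 (eqP (m0 i)).
Qed.

Lemma dyadic_shellP d (m : 'rV[int]_d) : m != 0%R ->
  exists i, dyadic_shell i m.
Proof.
rewrite -znorm1_eq0 -lt0n => m0; exists (trunc_log 2 (znorm1 m)).
by rewrite /dyadic_shell/= trunc_logP//= trunc_log_ltn.
Qed.

Lemma trivIset_dyadic_shell d : trivIset [set: nat] (@dyadic_shell d).
Proof.
apply/trivIsetP => i j _ _ ij; rewrite -subset0 => m [/= /andP[im mi] /andP[jm mj]].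
have := leq_ltn_trans im mj; have := leq_ltn_trans jm mi.
rewrite !ltn_exp2l// !ltnS => ji ij'.
by move: ij; rewrite eqn_leq ij' ji.
Qed.

Lemma esum_dyadic_le (R : realType) d (a : 'rV[int]_d -> \bar R)
    (w : 'rV[int]_d -> R) (c u : nat -> R) (T : R) :
  (forall m, 0 <= a m) -> (forall m, 0 <= w m)%R -> (forall i, 0 <= c i)%R ->
  (forall i m, dyadic_shell i m -> (w m <= c i)%R) ->
  (forall i, \esum_(m in @dyadic_shell d i) a m <= (u i)%:E) ->
  (forall n, (\sum_(i < n) c i * u i <= T)%R) ->
  \esum_(m in [set: 'rV[int]_d]) ((w m)%:E * a m) <=
    (w 0%R)%:E * a 0%R + T%:E.
Proof.
move=> a0 w0 c0 wc au cuT.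
have wa0 m : 0 <= (w m)%:E * a m by rewrite mule_ge0// lee_fin.
rewrite (esumID [set 0%R])// !setTI esum_set1// leeD2l//.
have -> : ~` [set 0%R] = \bigcup_i @dyadic_shell d i.
  apply/seteqP; split=> [m /= /eqP /dyadic_shellP[i mi]|m [i _ /andP[+ _]] /= m0].
    by exists i.
  by rewrite m0 (eqP (_ : znorm1 (0 : 'rV[int]_d) == 0)%N) ?znorm1_eq0// leqn0 expn_eq0.
rewrite nneseries_sum_bigcup//; last exact: trivIset_dyadic_shell.
apply: lime_le; first by apply: is_cvg_nneseries => *; exact: esum_ge0.
apply: nearW => n; apply: (@le_trans _ _ (\sum_(0 <= i < n) (c i * u i)%:E)).
  apply: lee_sum => i _; rewrite EFinM.
  apply: (@le_trans _ _ (\esum_(m in @dyadic_shell d i) ((c i)%:E * a m))).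
    by apply: le_esum => m mi; rewrite lee_wpmul2r// lee_fin wc.
  by rewrite esumZl// lee_wpmul2l// lee_fin.
by rewrite big_mkord sumEFin lee_fin.
Qed.

(** * The automorphism group and its generators *)

Lemma C0norm_multiplier_fine (R : realType) d (f : 'rV[int]_d -> R[i])
    (A : zmat R d) : C0 A ->
  C0norm (multiplier f A) =
  \esum_(m in [set: 'rV[int]_d]) (normc (f m) * fine (diag_sup A m))%:E.
Proof.
move=> CA; rewrite C0norm_multiplier; apply: eq_esum => m _.
by rewrite EFinM fineK// C0_diag_sup_fin.
Qed.

Lemma cvg0_lt (R : realType) (T : Type) (F : set_system T) {FF : Filter F}
    (f : T -> \bar R) (e : R) :
  (0 < e)%R -> f @ F --> 0 -> \forall t \near F, f t < e%:E.
Proof.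
move=> e0 /fine_cvgP[fin /cvgrPdist_lt /(_ e e0) f0].
near=> t; have ft : f t \is a fin_num by near: t.
rewrite -(fineK ft) lte_fin; apply: le_lt_trans (ler_norm _) _.
by rewrite -normrN -sub0r; near: t; exact: f0.
Unshelve. all: by end_near. Qed.

Lemma multiplier_cvg0 (R : realType) d (T : Type) (F : set_system T)
    {FF : ProperFilter F} (A : zmat R d) (f : T -> 'rV[int]_d -> R[i])
    (g : 'rV[int]_d -> R) :
  C0 A ->
  (\forall t \near F, forall m, (normc (f t m) <= g m)%R) ->
  \esum_(m in [set: 'rV[int]_d]) (g m * fine (diag_sup A m))%:E < +oo ->
  (forall m, normc (f t m) @[t --> F] --> (0 : R)%R) ->
  C0norm (multiplier (f t) A) @[t --> F] --> 0.
Proof.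
move=> CA fg gfin f0; under eq_cvg do rewrite C0norm_multiplier_fine//.
apply: (dominated_esum_cvg0 (v := fun m => g m * fine (diag_sup A m))%R) => //.
  near=> t => m; rewrite mulr_ge0 ?normc_ge0 ?fine_ge0 ?diag_sup_ge0//=.
  rewrite ler_wpM2r ?fine_ge0 ?diag_sup_ge0//; move: m.
  by near: t.
move=> m; rewrite -(mul0r (fine (diag_sup A m))).
by apply: cvgMr_tmp; exact: f0.
Unshelve. all: by end_near. Qed.

Lemma chi_sub_multiplier (R : realType) d (t : 'rV[R]_d) (A : zmat R d) :
  (chi t A - A)%R =
  multiplier (fun m => expi (2 * pi * zdot m t) - 1)%R A.
Proof.
by apply/funext => k; apply/funext => l; rewrite /multiplier mulrBl mul1r.
Qed.

Lemma zdot_norm_le (R : realType) d (m : 'rV[int]_d) (t : 'rV[R]_d) :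
  (`|zdot m t| <= (znorm1 m)%:R * rnorm1 t)%R.
Proof.
apply: le_trans (ler_norm_sum _ _ _) _; rewrite /rnorm1 mulr_sumr.
apply: ler_sum => i _; rewrite normrM ler_wpM2r// -intr_norm -abszE -pmulrn.
by rewrite ler_nat /znorm1 (bigD1 i)//= leq_addr.
Qed.

Lemma zdot_cvg0 (R : realType) d (m : 'rV[int]_d) :
  zdot m t @[t --> (0%R : 'rV[R]_d)] --> (0 : R)%R.
Proof.
rewrite /zdot.
have := @cvg_big _ _ _ 0%R xpredT (@add_continuous R) _
  (nbhs (0%R : 'rV[R]_d)) (index_enum 'I_d)
  (fun i t => (m ord0 i)%:~R * t ord0 i)%R (fun=> 0%R) _.
rewrite big1// => H; apply: H => i _; rewrite -(mulr0 (m ord0 i)%:~R).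
apply: cvgMl_tmp.
by have := @coord_continuous R 1 d ord0 i 0%R; rewrite /continuous_at mxE.
Qed.

Lemma chi_continuousE (R : realType) d : @chi_continuous R d = @C0 R d.
Proof.
apply/seteqP; split=> [A []//|A CA]; split=> //.
under eq_cvg do rewrite chi_sub_multiplier.
apply: (@multiplier_cvg0 R d _ (nbhs (0%R : 'rV[R]_d)) _ A _ (fun=> 2%R)) => //.
- by apply: nearW => t m; exact: expi_sub1_le2.
- under eq_esum => m _ do rewrite EFinM fineK ?C0_diag_sup_fin//.
  by rewrite esumZl// ?lte_mul_pinfty// => m; exact: diag_sup_ge0.
move=> m; apply: (@squeeze_cvgr _ (nbhs (0%R : 'rV[R]_d)) _ R (cst 0%R)
  (fun t => 2 * `|2 * pi * zdot m t|)%R).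
- by apply: nearW => t; rewrite normc_ge0 expi_sub1_le.
- exact: cvg_cst.
have := cvgMl_tmp (a := 2%R) (cvg_norm (cvgMl_tmp (a := (2 * pi)%R) (@zdot_cvg0 R d m))).
by rewrite mulr0 normr0 mulr0 => H; exact: H.
Qed.

Definition delta_symbol (R : realType) d (j : 'I_d) (m : 'rV[int]_d) : R[i] :=
  ((2 * pi * (m ord0 j)%:~R)%:C%C * 'i%C)%R.

Lemma normc_delta_symbol (R : realType) d (j : 'I_d) (m : 'rV[int]_d) :
  normc (delta_symbol R j m) = (2 * pi * (absz (m ord0 j))%:R)%R.
Proof.
rewrite /delta_symbol normcM normc_i mulr1 normc_real normrM ger0_norm; last first.
  by rewrite mulr_ge0// pi_ge0.
by rewrite -intr_norm -abszE -pmulrn.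
Qed.

Lemma zdot_delta (R : realType) d (j : 'I_d) (m : 'rV[int]_d) (h : R) :
  zdot m (h *: delta_mx ord0 j) = (h * (m ord0 j)%:~R)%R.
Proof.
rewrite /zdot (bigD1 j)//= big1 ?addr0 => [|i ij].
  by rewrite !mxE !eqxx mulr1 mulrC.
by rewrite !mxE eqxx (negPf ij) !mulr0.
Qed.

Definition quotient_symbol (R : realType) d (j : 'I_d) (h : R)
    (m : 'rV[int]_d) : R[i] :=
  ((h^-1)%:C%C * (expi (2 * pi * zdot m (h *: delta_mx ord0 j)) - 1)
   - delta_symbol R j m)%R.

Lemma quotient_symbol_le (R : realType) d (j : 'I_d) (h : R) m : h != 0%R ->
  (normc (quotient_symbol j h m) <= 2 * normc (delta_symbol R j m) ^+ 2 * `|h|)%R.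
Proof.
move=> h0; pose x : R := (2 * pi * (m ord0 j)%:~R)%R.
have -> : quotient_symbol j h m =
    ((h^-1)%:C%C * (expi (x * h) - 1 - (x * h)%:C%C * 'i%C))%R.
  rewrite /quotient_symbol zdot_delta [RHS]mulrBr; congr (_ * (expi _ - _) - _)%R.
    by rewrite /x; ring.
  rewrite /delta_symbol -/x mulrA -[in RHS](rmorphM (real_complex R)).
  by rewrite mulrCA mulVf// mulr1.
have -> : normc (delta_symbol R j m) = `|x|%R.
  by rewrite normcM normc_i mulr1 normc_real.
rewrite normcM normc_real normrV ?unitfE//.
rewrite ler_pdivrMl ?normr_gt0//; apply: le_trans (expi_taylor2 _) _.
rewrite exprMn -(real_normK (num_real x)) -(real_normK (num_real h)).
by rewrite le_eqVlt; apply/orP; left; apply/eqP; ring.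
Qed.

Lemma quotient_symbol_le_dom (R : realType) d (j : 'I_d) (h : R) m : h != 0%R ->
  (normc (quotient_symbol j h m) <= 3 * normc (delta_symbol R j m))%R.
Proof.
move=> h0; apply: le_trans (normc_triangle _ _) _.
rewrite normc_opp.
suff : (normc ((h^-1)%:C%C * (expi (2 * pi * zdot m (h *: delta_mx ord0 j)) - 1))
    <= 2 * normc (delta_symbol R j m))%R by lra.
rewrite normcM normc_real normrV ?unitfE// ler_pdivrMl ?normr_gt0//.
apply: le_trans (expi_sub1_le _) _; rewrite zdot_delta.
rewrite [normc (delta_symbol R j m)]normcM normc_i mulr1 normc_real !normrM.
by rewrite le_eqVlt; apply/orP; left; apply/eqP; ring.
Qed.

Lemma quotient_symbol_cvg0 (R : realType) d (j : 'I_d) m :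
  normc (quotient_symbol j h m) @[h --> (0%R : R)^'] --> (0 : R)%R.
Proof.
apply: (@squeeze_cvgr _ ((0%R : R)^') _ R (cst 0%R)
  (fun h => 2 * normc (delta_symbol R j m) ^+ 2 * `|h|)%R).
- near=> h; rewrite normc_ge0/=; apply: quotient_symbol_le.
  by near: h; exact: nbhs_dnbhs_neq.
- exact: cvg_cst.
have id0 : h @[h --> (0%R : R)^'] --> (0 : R)%R by exact: cvg_within.
have := cvgMl_tmp (a := (2 * normc (delta_symbol R j m) ^+ 2)%R) (cvg_norm id0).
by rewrite normr0 mulr0 => H; exact: H.
Unshelve. all: by end_near. Qed.

Lemma is_deltaP (R : realType) d (j : 'I_d) (A B : zmat R d) :
  is_delta j A B <->
  [/\ C0 A, C0 B & B = multiplier (delta_symbol R j) A].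
Proof.
have symb h : (fun k l => ((h^-1)%:C%C * (chi (h *: delta_mx ord0 j) A - A) k l
    - (multiplier (delta_symbol R j) A) k l)%R) =
    multiplier (quotient_symbol j h) A.
  apply/funext => k; apply/funext => l.
  by rewrite chi_sub_multiplier /multiplier mulrA -mulrBl.
split=> [[CA CB lim0]|[CA CB BE]]; split=> //; last first.
  subst B; under eq_cvg do rewrite symb.
  apply: (@multiplier_cvg0 R d _ ((0%R : R)^') _ A _
    (fun m => 3 * normc (delta_symbol R j m))%R) => //.
  - near=> h => m; apply: quotient_symbol_le_dom.
    by near: h; exact: nbhs_dnbhs_neq.
  - under eq_esum => m _ do rewrite -mulrA EFinM.
    rewrite esumZl// => [|m]; last first.
      by rewrite lee_fin mulr_ge0 ?normc_ge0 ?fine_ge0 ?diag_sup_ge0.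
    by rewrite -C0norm_multiplier_fine// lte_mul_pinfty.
  - by move=> m; exact: quotient_symbol_cvg0.
apply/funext => k; apply/funext => l; apply/eqP; rewrite -subr_eq0.
apply/eqP/eq0_normc/eqP; rewrite eq_le normc_ge0 andbT.
apply/ler_addgt0Pl => e e0; rewrite addr0.
have e2 : (0 < e / 2)%R by rewrite divr_gt0.
have small : \forall h \near (0%R : R)^',
    (normc (quotient_symbol j h (k - l)) * normc (A k l) < e / 2)%R.
  have : (normc (quotient_symbol j h (k - l)) * normc (A k l))%R
      @[h --> (0%R : R)^'] --> (0 : R)%R.
    have := cvgMr_tmp (b := normc (A k l)) (@quotient_symbol_cvg0 R d j (k - l)).
    by rewrite mul0r => H; exact: H.
  move=> /cvgrPdist_lt /(_ _ e2); apply: filterS => h.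
  by rewrite sub0r normrN; apply: le_lt_trans; exact: ler_norm.
have [h [h1 h2]] : exists h, C0norm (fun k l => ((h^-1)%:C%C *
    (chi (h *: delta_mx ord0 j) A - A) k l - B k l)%R) < (e / 2)%:E /\
    (normc (quotient_symbol j h (k - l)) * normc (A k l) < e / 2)%R.
  apply: (@filter_ex _ ((0%R : R)^') _); apply: filterI => //.
  by apply: cvg0_lt lim0.
have := le_lt_trans (entry_le_C0norm _ k l) h1; rewrite lte_fin => {}h1.
rewrite -normcM in h2; rewrite (splitr e).
rewrite [X in normc X](_ : _ =
  (quotient_symbol j h (k - l) * A k l) -
   ((h^-1)%:C%C * (chi (h *: delta_mx ord0 j) A - A)%R k l - B k l))%R.
  apply: le_trans (normc_triangle _ _) _; apply: lerD; by rewrite ?normc_opp ltW.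
by rewrite chi_sub_multiplier /multiplier /quotient_symbol; ring.
Unshelve. all: by end_near. Qed.

(** * Iterated generators *)

Definition monomial_symbol (R : realType) d (s : seq 'I_d) (m : 'rV[int]_d) :
  R[i] := (\prod_(j <- s) delta_symbol R j m)%R.

Lemma multiplier_comp (R : realType) d (f g : 'rV[int]_d -> R[i]) (A : zmat R d) :
  multiplier f (multiplier g A) = multiplier (fun m => f m * g m)%R A.
Proof. by apply/funext => k; apply/funext => l; rewrite /multiplier mulrA. Qed.

Lemma is_delta_seqE (R : realType) d (s : seq 'I_d) (A B : zmat R d) :
  C0 A -> is_delta_seq s A B -> C0 B /\ B = multiplier (monomial_symbol R s) A.
Proof.
move=> CA; elim: s B => [|j s IH] B /=.
  move=> <-; split=> //; apply/funext => k; apply/funext => l.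
  by rewrite /multiplier /monomial_symbol big_nil mul1r.
move=> [A' /IH[_ ->] /is_deltaP[_ CB BE]]; subst B; split=> //.
rewrite multiplier_comp; congr multiplier; apply/funext => m.
by rewrite /monomial_symbol big_cons.
Qed.

Lemma is_delta_seq_multiplier (R : realType) d (A : zmat R d) n :
  C0 A ->
  (forall s, (size s <= n)%N -> C0 (multiplier (monomial_symbol R s) A)) ->
  forall s, (size s <= n)%N ->
    is_delta_seq s A (multiplier (monomial_symbol R s) A).
Proof.
move=> CA Cs; elim=> [|j s IH] sn /=.
  apply/funext => k; apply/funext => l.
  by rewrite /multiplier /monomial_symbol big_nil mul1r.
exists (multiplier (monomial_symbol R s) A); first exact/IH/ltnW.
apply/is_deltaP; split; [exact/Cs/ltnW|exact: (Cs (j :: s) sn)|].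
rewrite multiplier_comp; congr multiplier; apply/funext => m.
by rewrite /monomial_symbol big_cons.
Qed.

Definition mindex_seq d k (alpha : mindex d k) : seq 'I_d :=
  flatten [seq nseq (alpha j) j | j <- enum 'I_d].

Lemma size_mindex_seq d k (alpha : mindex d k) :
  size (mindex_seq alpha) = mdegree alpha.
Proof.
rewrite size_flatten /shape -map_comp sumnE big_map big_enum /=.
by apply: eq_bigr => j _; rewrite size_nseq.
Qed.

Lemma delta_powE (R : realType) d k (alpha : mindex d k) (A B : zmat R d) :
  C0 A -> is_delta_pow alpha A B ->
  C0 B /\ delta_pow alpha A = multiplier (monomial_symbol R (mindex_seq alpha)) A.
Proof.
move=> CA AB; have [CB _] := is_delta_seqE CA AB; split=> //.
rewrite /delta_pow; case: xgetP => [_ _ /(is_delta_seqE CA)[]//|none].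
by case: (none B).
Qed.

Lemma normc_monomial_symbol_le (R : realType) d (s : seq 'I_d) m :
  (normc (monomial_symbol R s m) <= (2 * pi * (znorm1 m)%:R) ^+ size s)%R.
Proof.
rewrite normc_prod; elim: s => [|j s IH]; first by rewrite big_nil.
rewrite big_cons [in leRHS]exprS ler_pM ?normc_ge0//.
  by apply: prodr_ge0 => i _; exact: normc_ge0.
rewrite normc_delta_symbol ler_wpM2l ?mulr_ge0 ?pi_ge0// ler_nat.
by rewrite /znorm1 (bigD1 j)//= leq_addr.
Qed.

Lemma geometric_sum_le (R : realType) (q : R) n :
  (0 <= q < 1)%R -> (\sum_(i < n) q ^+ i <= (1 - q)^-1)%R.
Proof.
move=> /andP[q0 q1]; rewrite -[leRHS]mul1r ler_pdivlMr ?subr_gt0// mulrC.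
by rewrite -opprB mulNr -subrX1 opprB lerBlDr lerDl exprn_ge0.
Qed.

Lemma powR2N_lt1 (R : realType) (x : R) : (0 < x)%R -> (2 `^ (- x) < 1 :> R)%R.
Proof.
move=> x0; rewrite powRN invf_lt1 ?powR_gt0//.
have := @gt0_ltr_powR R x x0 1%R 2%R; rewrite powR1; apply; rewrite ?nnegrE//.
by rewrite ltr1n.
Qed.

Lemma dyadic_zygmund_sum_le (R : realType) (eta : R) : (0 < eta <= 1)%R ->
  exists2 Z : R, (0 <= Z)%R & forall n (x : R), (0 < x)%R ->
    (\sum_(i < n) Num.min 1 (4 ^+ i * x ^+ 2) * (2 `^ (- eta)) ^+ i
      <= Z * x `^ eta)%R.
Proof.
move=> /andP[eta0 eta1]; have := @powR2N_lt1 R eta eta0.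
set p : R := (2 `^ (- eta))%R => p1.
have p_half : (1 / 2 <= p)%R.
  rewrite mul1r -(powR_inv1 (ler0n R 2)) /p; apply: ler_powR; first lra.
  by rewrite lerN2.
pose K : R := ((1 - p)^-1)%R; have K1 : (1 + p * K = K)%R.
  by rewrite /K; field; rewrite subr_eq0 gt_eqF.
have K0 : (0 < K)%R by rewrite invr_gt0 subr_gt0.
pose Z : R := (K + 4)%R.
have pow_ge (x : R) : (0 < x)%R -> (x < 1)%R -> (x ^+ 2 <= x <= x `^ eta)%R.
  move=> x0 x1; apply/andP; split; first by rewrite expr2 ler_piMr// ltW.
  by apply: ger1_powR => //; rewrite x0 ltW.
(* [F] is a supersolution of S (n+1) x = min 1 (x^2) + p * S n (2 x). *)
pose F (x : R) := (if 1 <= x then K else Z * x `^ eta - x ^+ 2)%R.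
have F_step (x : R) : (0 < x)%R -> (Num.min 1 (x ^+ 2) + p * F (2 * x) <= F x)%R.
  move=> x0; have pow2 : (p * (2 * x) `^ eta = x `^ eta)%R.
    rewrite powRM ?ltW// mulrA /p powRN mulVf ?mul1r// powR_eq0 pnatr_eq0.
  rewrite /F; case: (leP 1%R x) => x1.
    have -> : (1 <= 2 * x)%R by lra.
    have : (Num.min 1 (x ^+ 2) <= 1)%R by rewrite ge_min lexx.
    by move: K1 {F}; clearbody K => K1; lra.
  have /andP[xx xeta] := pow_ge _ x0 x1.
  have min_le : (Num.min 1 (x ^+ 2) <= x ^+ 2)%R by rewrite ge_min lexx orbT.
  case: ifPn => x2; last first.
    have -> : (p * (Z * (2 * x) `^ eta - (2 * x) ^+ 2) =
        Z * x `^ eta - p * 4 * x ^+ 2)%R by rewrite -pow2; ring.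
    have := sqr_ge0 x; nra.
  have px : (p <= x `^ eta)%R.
    have -> : p = ((2^-1) `^ eta)%R.
      by rewrite -(powR_inv1 (ler0n R 2)) -powRrM mulN1r.
    by apply: ge0_ler_powR; rewrite ?nnegrE; lra.
  have : (p * K <= K * x `^ eta)%R by rewrite mulrC ler_pM2l.
  rewrite /Z; lra.
have SF n (x : R) : (0 < x)%R ->
    (\sum_(i < n) Num.min 1 (4 ^+ i * x ^+ 2) * p ^+ i <= F x)%R.
  elim: n x => [|n IH] x x0.
    rewrite big_ord0 /F; case: ifPn => [_|]; first exact: ltW.
    rewrite -ltNge => x1; have /andP[h1 h2] := pow_ge _ x0 x1.
    have : (0 <= K * x `^ eta)%R by rewrite mulr_ge0 ?powR_ge0// ltW.
    rewrite /Z; have := powR_ge0 x eta; lra.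
  rewrite big_ord_recl/= !expr0 mul1r mulr1.
  have -> : (\sum_(i < n) Num.min 1 (4 ^+ bump 0 i * x ^+ 2) * p ^+ bump 0 i =
      p * \sum_(i < n) Num.min 1 (4 ^+ i * (2 * x) ^+ 2) * p ^+ i)%R.
    rewrite mulr_sumr; apply: eq_bigr => i _; rewrite /bump add1n (exprS p) (exprS 4%R).
    rewrite (_ : 4 ^+ i * (2 * x) ^+ 2 = 4 * 4 ^+ i * x ^+ 2)%R; last by ring.
    by rewrite mulrCA.
  have x20 : (0 < 2 * x)%R by rewrite mulr_gt0.
  apply: le_trans (F_step x x0); rewrite lerD2l ler_wpM2l ?powR_ge0//.
  exact: IH.
exists Z => [|n x x0]; first by rewrite addr_ge0// ltW.
apply: le_trans (SF n x x0) _; rewrite /F; case: ifPn => [x1|_]; last first.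
  by rewrite gerBl sqr_ge0.
have : (1 <= x `^ eta)%R.
  by rewrite -(powRr0 x); apply: ler_powR => //; exact: ltW.
rewrite /Z; nra.
Qed.

Local Arguments normc : simpl never.

(** * The approximation error *)

Lemma finite_znorm1_lt d N : finite_set [set m : 'rV[int]_d | (znorm1 m < N)%N].
Proof.
pose f (g : {ffun 'I_d -> 'I_N.*2.+1}) : 'rV[int]_d :=
  (\row_i ((nat_of_ord (g i))%:Z - N%:Z))%R.
apply: (@sub_finite_set _ _ (f @` [set: {ffun 'I_d -> 'I_N.*2.+1}])); last first.
  by apply: finite_image; exact: finite_finset.
move=> m /= mN.
have mi i : (absz (m ord0 i) < N)%N.
  by apply: leq_ltn_trans mN; rewrite /znorm1 (bigD1 i)//= leq_addr.
exists [ffun i => inord (absz (m ord0 i + N%:Z)%R)] => //.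
apply/rowP => i; rewrite mxE ffunE inordK; last by have := mi i; lia.
rewrite (_ : m 0%R i = m ord0 i) //; have := mi i; move: (m ord0 i) => z; lia.
Qed.

Lemma sum_side_diagE (R : realType) d N (A : zmat R d) x y :
  (\sum_(k \in [set k : 'rV[int]_d | (znorm1 k < N)%N]) side_diag k A)%R x y =
  if (znorm1 (x - y)%R < N)%N then A x y else 0%R.
Proof.
rewrite fsbig_finite; last exact: finite_znorm1_lt.
rewrite !fct_sumE.
rewrite /side_diag; case: ifPn => xyN; last first.
  rewrite big1_seq// => k /andP[_]; rewrite (in_fset_set (finite_znorm1_lt d N)) in_setE/=.
  by move=> /= kN; case: eqP => // xyk; rewrite xyk kN in xyN.
rewrite (bigD1_seq (x - y)%R) ?fset_uniq//=; last first.
  by rewrite (in_fset_set (finite_znorm1_lt d N)) in_setE.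
by rewrite eqxx big1 ?addr0// => k /negPf; rewrite eq_sym => ->.
Qed.

Lemma sub_multiplier (R : realType) d (f : 'rV[int]_d -> R[i]) (A : zmat R d) :
  (A - multiplier f A)%R = multiplier (fun m => 1 - f m)%R A.
Proof.
by apply/funext => k; apply/funext => l; rewrite /multiplier mulrBl mul1r.
Qed.

Lemma approx_error_tail (R : realType) d N (A : zmat R d) : C0 A ->
  approx_error N A =
  \esum_(m in [set m : 'rV[int]_d | (N <= znorm1 m)%N]) diag_sup A m.
Proof.
move=> CA; apply/eqP; rewrite eq_le; apply/andP; split.
  pose f (m : 'rV[int]_d) : R[i] := if (znorm1 m < N)%N then 1%R else 0%R.
  have -> : \esum_(m in [set m : 'rV[int]_d | (N <= znorm1 m)%N]) diag_sup A m =
      C0norm (A - multiplier f A)%R.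
    rewrite sub_multiplier.
    rewrite C0norm_multiplier esum_mkcond; apply: eq_esum => m _.
    rewrite /f; case: ltnP => h.
      rewrite memNset/=; last by apply/negP; rewrite -ltnNge.
      by rewrite subrr normc_zero mul0e.
    by rewrite mem_set//= subr0 normc_one mul1e.
  apply: ereal_inf_lbound; exists (multiplier f A) => //; split.
    rewrite /C0/= C0norm_multiplier; apply: le_lt_trans CA.
    apply: le_esum => m _; rewrite /f; case: ifP => _.
      by rewrite normc_one mul1e.
    by rewrite normc_zero mul0e diag_sup_ge0.
  apply/funext => x; apply/funext => y; rewrite sum_side_diagE.
  by rewrite /multiplier /f; case: ifP => _; rewrite ?mul1r ?mul0r.
apply: le_ereal_inf_tmp => _ [B [_ BE] <-].
rewrite esum_mkcond; apply: le_esum => m _; case: ifPn; last first.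
  by move=> _; exact: diag_sup_ge0.
rewrite in_setE/= => mN; rewrite le_eqVlt; apply/orP; left; apply/eqP.
congr ereal_sup; apply: eq_imagel => l _; congr (normc _)%:E.
have -> : (A - B)%R l (l - m)%R = (A l (l - m) - B l (l - m))%R by [].
by rewrite [in RHS]BE sum_side_diagE subKr ltnNge mN subr0.
Qed.

(** * Dyadic shells and approximation *)

Definition dyadic_bound (R : realType) d (r K : R) (A : zmat R d) : Prop :=
  diag_sup A 0%R <= K%:E /\
  forall i, \esum_(m in @dyadic_shell d i) diag_sup A m <=
            (K * (2 `^ (- r)) ^+ i)%:E.

Lemma le_mul2 (R : realType) (x y : R) (a b : \bar R) :
  (0 <= x)%R -> 0 <= a -> (x <= y)%R -> a <= b -> x%:E * a <= y%:E * b.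
Proof.
by move=> x0 a0 xy ab; apply: lee_pmul => //; rewrite lee_fin.
Qed.

Lemma powR2_mulrn (R : realType) (r : R) (i : nat) :
  (2 `^ (r * i%:R) = (2 `^ r) ^+ i)%R.
Proof. by rewrite powRrM powR_mulrn// powR_ge0. Qed.

Lemma powR2N_mul (R : realType) (r : R) (i : nat) :
  ((2 `^ r) ^+ i * (2 `^ (- r)) ^+ i = 1)%R.
Proof.
by rewrite -exprMn powRN mulfV ?expr1n// powR_eq0 pnatr_eq0.
Qed.

Lemma dyadic_bound_ge0 (R : realType) d (r K : R) (A : zmat R d) :
  dyadic_bound r K A -> (0 <= K)%R.
Proof. by case=> aK _; rewrite -lee_fin (le_trans _ aK)// diag_sup_ge0. Qed.

Lemma weighted_dyadic_le (R : realType) d (r K T : R) (A : zmat R d)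
    (w : 'rV[int]_d -> R) (c : nat -> R) :
  dyadic_bound r K A -> (forall m, 0 <= w m)%R -> (forall i, 0 <= c i)%R ->
  (forall i m, dyadic_shell i m -> (w m <= c i)%R) ->
  (forall n, (\sum_(i < n) c i * (K * (2 `^ (- r)) ^+ i) <= T)%R) ->
  \esum_(m in [set: 'rV[int]_d]) ((w m)%:E * diag_sup A m) <=
    (w 0%R * K + T)%:E.
Proof.
move=> [a0K aK] w0 c0 wc cT.
apply: le_trans (esum_dyadic_le (@diag_sup_ge0 _ _ A) w0 c0 wc aK cT) _.
by rewrite EFinD leeD2r// EFinM lee_wpmul2l// lee_fin.
Qed.

Lemma approx_dyadic_bound (R : realType) d (r M : R) (A : zmat R d) :
  (0 < r)%R -> C0 A -> approx_norm r A <= M%:E -> dyadic_bound r M A.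
Proof.
move=> r0 CA AM.
have EM N : approx_error N A * (N.+1%:R `^ r)%:E <= M%:E.
  by apply: le_trans AM; apply: ereal_sup_ubound; exists N.
split.
  have := EM 0%N; rewrite powR1 mule1 approx_error_tail//; apply: le_trans.
  by apply: esum_ge; exists [set 0%R]; [split|rewrite fsbig_set1].
move=> i; have := EM (2 ^ i)%N; rewrite approx_error_tail//.
set t := (X in X * _) => tM.
have tge : \esum_(m in @dyadic_shell d i) diag_sup A m <= t.
  rewrite /t esum_mkcond [leRHS]esum_mkcond; apply: le_esum => m _.
  case: ifPn => [|_]; last by case: ifP => // _; exact: diag_sup_ge0.
  by rewrite in_setE => /andP[im _]; rewrite mem_set.
apply: le_trans tge _; have t0 : 0 <= t by apply: esum_ge0 => m _; exact: diag_sup_ge0.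
have q0 : 0 <= ((2 `^ (- r)) ^+ i)%:E :> \bar R by rewrite lee_fin exprn_ge0 ?powR_ge0.
have pow_le : ((2 `^ r) ^+ i <= (2 ^ i).+1%:R `^ r :> R)%R.
  rewrite -powR_mulrn ?powR_ge0// powRAC powR_mulrn//.
  by rewrite ge0_ler_powR ?(ltW r0) ?nnegrE ?exprn_ge0// -natrX ler_nat.
have -> : t = t * ((2 `^ r) ^+ i)%:E * ((2 `^ (- r)) ^+ i)%:E.
  by rewrite -muleA -EFinM powR2N_mul mule1.
rewrite [leRHS]EFinM.
rewrite lee_wpmul2r//; apply: le_trans tM.
by rewrite lee_wpmul2l// lee_fin.
Qed.

Lemma dyadic_bound_C0 (R : realType) d (r K : R) (A : zmat R d) :
  (0 < r)%R -> dyadic_bound r K A -> C0 A.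
Proof.
move=> r0 AK; have K0 := dyadic_bound_ge0 AK.
have : \esum_(m in [set: 'rV[int]_d]) (1%:E * diag_sup A m) <=
    (1 * K + K * (1 - 2 `^ (- r))^-1)%:E.
  apply: (@weighted_dyadic_le _ _ r K _ A (fun=> 1%R) (fun=> 1%R)) => // n.
  under eq_bigr do rewrite mul1r.
  by rewrite -mulr_sumr ler_wpM2l// geometric_sum_le// powR_ge0 powR2N_lt1.
by under eq_esum do rewrite mul1e; move=> /le_lt_trans; apply; exact: ltry.
Qed.

Lemma dyadic_bound_approx (R : realType) d (r : R) : (0 < r)%R ->
  exists2 G : R, (0 < G)%R & forall (K : R) (A : zmat R d),
    dyadic_bound r K A -> approx_norm r A <= (G * K)%:E.
Proof.
move=> r0; pose q : R := (2 `^ (- r))%R.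
have q0 : (0 <= q)%R by exact: powR_ge0.
have q1 : (q < 1)%R by exact: powR2N_lt1.
have g0 : (0 < (1 - q)^-1)%R by rewrite invr_gt0 subr_gt0.
exists (1 + 2 `^ r * (1 - q)^-1)%R.
  by rewrite ltr_wpDr// mulr_ge0 ?powR_ge0// ltW.
move=> K A AK; have K0 := dyadic_bound_ge0 AK.
have CA := dyadic_bound_C0 r0 AK.
apply: ge_ereal_sup => _ [N _ <-]; rewrite approx_error_tail//.
pose w (m : 'rV[int]_d) : R := ((N <= znorm1 m)%N%:R)%R.
have -> : \esum_(m in [set m : 'rV[int]_d | (N <= znorm1 m)%N]) diag_sup A m =
    \esum_(m in [set: 'rV[int]_d]) ((w m)%:E * diag_sup A m).
  rewrite esum_mkcond; apply: eq_esum => m _; rewrite /w.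
  case: ifPn; first by rewrite in_setE/= => ->; rewrite mul1e.
  by rewrite notin_setE/= => /negP/negPf ->; rewrite mul0e.
pose i0 := trunc_log 2 N.
have : \esum_(m in [set: 'rV[int]_d]) ((w m)%:E * diag_sup A m) <=
    (w 0%R * K + K * (q ^+ i0 * (1 - q)^-1))%:E.
  apply: (@weighted_dyadic_le _ _ r K _ A w (fun i => ((i0 <= i)%N%:R)%R)) => //.
  - move=> i m /andP[im mi]; rewrite ler_nat; case: (leqP N _) => //= Nm.
    rewrite lt0b; have [N0|N0] := posnP N; first by rewrite /i0 N0 trunc_log0.
    rewrite -ltnS -(@ltn_exp2l 2)// (leq_ltn_trans _ mi)// (leq_trans _ Nm)//.
    exact: trunc_logP.
  move=> n; under eq_bigr do rewrite mulrCA.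
  rewrite -mulr_sumr ler_wpM2l//.
  have [ni0|i0n] := leqP n i0.
    rewrite big1 => [|i _]; first by rewrite mulr_ge0 ?exprn_ge0// ltW.
    by rewrite leqNgt (leq_trans (ltn_ord i) ni0) mul0r.
  rewrite -(big_mkord xpredT (fun i => (i0 <= i)%N%:R * q ^+ i)%R).
  rewrite (big_cat_nat (n := i0)) ?leq0n 1?ltnW//= big1_seq ?add0r; last first.
    by move=> i; rewrite mem_index_iota => /andP[_ /andP[_ ii0]]; rewrite leqNgt ii0 mul0r.
  rewrite -{1}[i0]add0n big_addn big_mkord.
  under eq_bigr => i _ do rewrite leq_addl mul1r exprD mulrC.
  rewrite -mulr_sumr ler_wpM2l ?exprn_ge0//.
  by apply: geometric_sum_le; rewrite q0.
move=> /(lee_wpmul2r (x := (N.+1%:R `^ r)%:E)) H.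
apply: le_trans (H _) _; first by rewrite lee_fin powR_ge0.
rewrite -EFinM lee_fin {H} -/q.
have [N0|N0] := posnP N.
  rewrite /i0 /w N0 trunc_log0 leq0n powR1 expr0 mulr1 mul1r mul1r.
  rewrite mulrDl mul1r lerD2l mulrC ler_wpM2r// ler_peMl ?(ltW g0)//.
  by rewrite -[leLHS](powRr0 (2 : R)) ler_powR ?(ltW r0)// ler1n.
rewrite /w (_ : (N <= _)%N = false); last first.
  by apply/negbTE; rewrite -ltnNge (eqP (_ : znorm1 0%R == 0)%N) ?znorm1_eq0.
rewrite mul0r add0r.
have powN : (q ^+ i0 * N.+1%:R `^ r <= 2 `^ r)%R.
  have : (N.+1%:R `^ r <= (2 ^+ i0.+1) `^ r :> R)%R.
    rewrite ge0_ler_powR ?(ltW r0) ?nnegrE ?ler0n ?exprn_ge0// -natrX ler_nat.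
    exact: trunc_log_ltn.
  move=> /(ler_wpM2l (exprn_ge0 i0 q0)) /le_trans; apply.
  rewrite -powR_mulrn// powRAC powR_mulrn ?powR_ge0// exprS mulrCA.
  by rewrite [(q ^+ _ * _)%R]mulrC powR2N_mul mulr1.
have -> : (K * (q ^+ i0 * (1 - q)^-1) * N.+1%:R `^ r =
  (q ^+ i0 * N.+1%:R `^ r) * ((1 - q)^-1 * K))%R by ring.
have gK : (0 <= (1 - q)^-1 * K)%R by rewrite mulr_ge0// ltW.
apply: le_trans (ler_wpM2r gK powN) _.
by rewrite mulrDl mul1r -mulrA lerDr.
Qed.

(** * From dyadic shells to the Zygmund norm *)

Lemma powR2N_split (R : realType) (k i : nat) (eta : R) :
  ((2 ^+ k) ^+ i * (2 `^ (- (k%:R + eta))) ^+ i = (2 `^ (- eta)) ^+ i :> R)%R.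
Proof.
rewrite -exprMn; congr (_ ^+ i)%R.
rewrite opprD powRD ?pnatr_eq0 ?implybT// mulrA (powRN 2 k%:R) powR_mulrn//.
by rewrite mulfV ?mul1r// expf_neq0// pnatr_eq0.
Qed.

Lemma pi4_ge1 (R : realType) : (1 <= 4 * pi :> R)%R.
Proof. by have := pi_ge2 R; lra. Qed.

Lemma monomial_symbol_shell_le (R : realType) d k (s : seq 'I_d) i m :
  (size s <= k)%N -> dyadic_shell i m ->
  (normc (monomial_symbol R s m) <= (4 * pi) ^+ k * (2 ^+ k) ^+ i)%R.
Proof.
move=> sk /andP[_ mi]; apply: le_trans (normc_monomial_symbol_le _ _ _) _.
have m_le : (2 * pi * (znorm1 m)%:R <= 4 * pi * 2 ^+ i :> R)%R.
  have : ((znorm1 m)%:R <= 2 ^+ i.+1 :> R)%R by rewrite -natrX ler_nat ltnW.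
  rewrite exprS; have := pi_gt0 R; nra.
have base0 : (0 <= 2 * pi * (znorm1 m)%:R :> R)%R by rewrite mulr_ge0// mulr_ge0// pi_ge0.
apply: (@le_trans _ _ ((4 * pi * 2 ^+ i) ^+ size s)%R).
  by rewrite lerXn2r// nnegrE// (le_trans base0).
rewrite exprAC -exprMn ler_weXn2l//.
have := pi4_ge1 R; have : (1 <= 2 ^+ i :> R)%R by rewrite exprn_ege1// ler1n.
nra.
Qed.

Lemma normc_monomial_symbol0_le (R : realType) d k (s : seq 'I_d) :
  (normc (monomial_symbol R s 0%R) <= (4 * pi) ^+ k)%R.
Proof.
apply: le_trans (normc_monomial_symbol_le _ _ _) _.
rewrite (eqP (_ : znorm1 0%R == 0)%N) ?znorm1_eq0// mulr0 expr0n.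
apply: (@le_trans _ _ 1%R); last by rewrite exprn_ege1// pi4_ge1.
by case: (_ == _).
Qed.

Lemma monomial_C0norm_le (R : realType) d (k : nat) (eta : R) :
  (0 < eta)%R ->
  exists2 G : R, (0 <= G)%R & forall (K : R) (A : zmat R d) (s : seq 'I_d),
    dyadic_bound (k%:R + eta) K A -> (size s <= k)%N ->
    C0norm (multiplier (monomial_symbol R s) A) <= (G * K)%:E.
Proof.
move=> eta0; pose p : R := (2 `^ (- eta))%R.
have p0 : (0 <= p)%R by exact: powR_ge0.
have p1 : (p < 1)%R by exact: powR2N_lt1.
have g0 : (0 <= (1 - p)^-1)%R by rewrite invr_ge0 subr_ge0 ltW.
have e0 : (0 <= (4 * pi) ^+ k :> R)%R.
  by rewrite exprn_ge0// (le_trans ler01)// pi4_ge1.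
exists ((4 * pi) ^+ k * (1 + (1 - p)^-1))%R; first by rewrite mulr_ge0// addr_ge0.
move=> K A s AK sk; have K0 := dyadic_bound_ge0 AK.
rewrite C0norm_multiplier.
apply: le_trans (@weighted_dyadic_le _ _ _ K
  ((4 * pi) ^+ k * K * (1 - p)^-1)%R A _
  (fun i => (4 * pi) ^+ k * (2 ^+ k) ^+ i)%R AK _ _ _ _) _.
- by move=> m; exact: normc_ge0.
- by move=> i; rewrite mulr_ge0// !exprn_ge0.
- by move=> i m mi; exact: monomial_symbol_shell_le.
- move=> n; under eq_bigr => i _.
    rewrite mulrACA powR2N_split -/p; over.
  by rewrite -mulr_sumr ler_wpM2l ?mulr_ge0 ?geometric_sum_le ?p0.
rewrite lee_fin [leRHS](_ : _ =
  (4 * pi) ^+ k * K + (4 * pi) ^+ k * K * (1 - p)^-1)%R; last by ring.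
by rewrite lerD2r ler_wpM2r// normc_monomial_symbol0_le.
Qed.

Lemma monomial_zygmund_le (R : realType) d (k : nat) (eta : R) :
  (0 < eta <= 1)%R ->
  exists2 G : R, (0 <= G)%R & forall (K : R) (A : zmat R d) (s : seq 'I_d),
    dyadic_bound (k%:R + eta) K A -> (size s <= k)%N ->
    zygmund_seminorm eta (multiplier (monomial_symbol R s) A) <= (G * K)%:E.
Proof.
move=> eta01; have [Z Z0 HZ] := dyadic_zygmund_sum_le eta01.
have /andP[eta0 eta1] := eta01.
have pi0 : (0 < 4 * pi :> R)%R by rewrite (lt_le_trans ltr01)// pi4_ge1.
have e0 : (0 <= (4 * pi) ^+ k :> R)%R by rewrite exprn_ge0// ltW.
exists (4 * (4 * pi) ^+ k * (Z * (4 * pi) `^ eta))%R.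
  by rewrite !mulr_ge0 ?powR_ge0.
move=> K A s AK sk; have K0 := dyadic_bound_ge0 AK.
apply: ge_ereal_sup => _ [t t0 <-].
have tn : (0 < rnorm1 t)%R.
  rewrite lt_neqAle sumr_ge0 ?andbT// eq_sym; apply: contra_neq t0.
  move=> /eqP; rewrite psumr_eq0// => /allP t0; apply/rowP => i.
  have := t0 i; rewrite mem_index_enum normr_eq0 mxE => /(_ isT)/eqP <-.
  by congr (t _ _); apply/val_inj.
rewrite /chi_diff !chi_sub_multiplier !multiplier_comp C0norm_multiplier.
set x := (4 * pi * rnorm1 t)%R.
have x0 : (0 < x)%R by rewrite mulr_gt0.
have bound : \esum_(m in [set: 'rV[int]_d]) ((normc ((expi (2 * pi * zdot m t) - 1) *
    (expi (2 * pi * zdot m t) - 1) * monomial_symbol R s m)%R)%:E * diag_sup A m) <=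
    (4 * (4 * pi) ^+ k * K * (Z * x `^ eta))%:E.
  apply: le_trans (@weighted_dyadic_le _ _ _ K
    (4 * (4 * pi) ^+ k * K * (Z * x `^ eta))%R A _
    (fun i => 4 * Num.min 1 (4 ^+ i * x ^+ 2) *
              ((4 * pi) ^+ k * (2 ^+ k) ^+ i))%R AK _ _ _ _) _.
  - by move=> m; exact: normc_ge0.
  - move=> i; apply: mulr_ge0; last by rewrite mulr_ge0// !exprn_ge0.
    by rewrite mulr_ge0// le_min ler01/= mulr_ge0 ?sqr_ge0// exprn_ge0.
  - move=> i m mi; rewrite normcM; apply: ler_pM; rewrite ?normc_ge0//.
      rewrite normcM -expr2 minr_pMr// mulr1 le_min; apply/andP; split.
        have := expi_sub1_le2 (2 * pi * zdot m t)%R.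
        have := normc_ge0 (expi (2 * pi * zdot m t) - 1)%R.
        move: (normc _) => z; nra.
      rewrite (_ : 4 * (4 ^+ i * x ^+ 2) = (2 * (2 ^+ i * x)) ^+ 2)%R; last first.
        rewrite !exprMn -exprM mulnC exprM (_ : 2 ^+ 2 = 4)%R//; by rewrite expr2 -natrM.
      rewrite lerXn2r ?nnegrE ?normc_ge0//.
        by rewrite mulr_ge0// mulr_ge0 ?exprn_ge0 ?(ltW x0).
      apply: le_trans (expi_sub1_le _) _; rewrite ler_wpM2l//.
      rewrite normrM ger0_norm ?mulr_ge0 ?pi_ge0//.
      have m_le : (`|zdot m t| <= 2 ^+ i.+1 * rnorm1 t)%R.
        apply: le_trans (zdot_norm_le _ _) _; rewrite ler_wpM2r ?(ltW tn)//.
        by move: mi => /andP[_ mi]; rewrite -natrX ler_nat ltnW.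
      move: m_le; rewrite exprS /x; have := pi_gt0 R; nra.
    exact: monomial_symbol_shell_le.
  - move=> n.
    rewrite (_ : (\sum_(i < n) _) = 4 * (4 * pi) ^+ k * K *
      \sum_(i < n) Num.min 1 (4 ^+ i * x ^+ 2) * (2 `^ (- eta)) ^+ i)%R.
      by rewrite ler_wpM2l ?mulr_ge0// HZ.
    rewrite mulr_sumr; apply: eq_bigr => i _.
    rewrite -(powR2N_split k i eta).
    move: (Num.min _ _) ((2 ^+ k) ^+ i)%R ((2 `^ _) ^+ i)%R ((4 * pi) ^+ k)%R.
    by move=> a b c e; ring.
  have -> : zdot 0%R t = 0%R.
    by rewrite /zdot big1// => i _; rewrite mxE mul0r.
  by rewrite mulr0 expi0 subrr !mul0r normc_zero mul0r add0r.
apply: le_trans (lee_wpmul2l _ bound) _; first by rewrite lee_fin powR_ge0.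
rewrite -EFinM lee_fin /x powRM ?(ltW tn) ?(ltW pi0)// powRN.
have tne : (rnorm1 t `^ eta != 0)%R by rewrite gt_eqF// powR_gt0.
by rewrite le_eqVlt; apply/orP; left; apply/eqP; field.
Qed.

Lemma dyadic_bound_hz (R : realType) d (k : nat) (eta : R) :
  (0 < eta <= 1)%R ->
  exists2 G : R, (0 < G)%R & forall (K : R) (A : zmat R d),
    dyadic_bound (k%:R + eta) K A ->
    Ck k A /\ hz_norm k eta A <= (G * K)%:E.
Proof.
move=> eta01; have /andP[eta0 _] := eta01.
have [G1 G10 HG1] := @monomial_C0norm_le R d k eta eta0.
have [G2 G20 HG2] := @monomial_zygmund_le R d k eta eta01.
pose N : R := (#|{: mindex d k}|%:R)%R.
exists (N * (G1 + G2) + 1)%R; first by rewrite ltr_wpDl// mulr_ge0// addr_ge0.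
move=> K A AK; have K0 := dyadic_bound_ge0 AK.
have CA : C0 A by apply: dyadic_bound_C0 AK; rewrite ltr_wpDl.
have Cs s : (size s <= k)%N -> C0 (multiplier (monomial_symbol R s) A).
  by move=> sk; apply: le_lt_trans (HG1 _ _ _ AK sk) (ltry _).
have pow alpha : (mdegree alpha <= k)%N ->
    is_delta_pow alpha A (multiplier (monomial_symbol R (@mindex_seq d k alpha)) A).
  move=> ak; apply: (is_delta_seq_multiplier CA Cs).
  by rewrite size_mindex_seq.
have powE (alpha : mindex d k) : (mdegree alpha <= k)%N ->
    delta_pow alpha A = multiplier (monomial_symbol R (mindex_seq alpha)) A.
  by move=> ak; have [] := delta_powE CA (pow _ ak).
split.
  split; first by rewrite chi_continuousE.
  move=> alpha ak; eexists; first exact: pow ak.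
  by rewrite chi_continuousE; apply: Cs; rewrite size_mindex_seq.
have sum_le (P : pred (mindex d k)) (F : mindex d k -> \bar R) (G : R) :
    (0 <= G)%R -> (forall alpha, P alpha -> F alpha <= (G * K)%:E) ->
    \sum_(alpha | P alpha) F alpha <= (N * G * K)%:E.
  move=> G0 FG; apply: (@le_trans _ _ (\sum_(alpha | P alpha) (G * K)%:E)).
    by apply: lee_sum => alpha; exact: FG.
  rewrite sumEFin lee_fin big_const iter_addr_0 -mulrA /N mulr_natl.
  by rewrite ler_wpMn2l ?mulr_ge0// max_card.
apply: (@le_trans _ _ ((N * G1 * K)%:E + (N * G2 * K)%:E)).
  apply: leeD; apply: sum_le => // alpha ak.
    rewrite powE//; apply: (@le_trans _ _ (1%:E * (G1 * K)%:E)); last by rewrite mul1e.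
    apply: le_mul2; rewrite ?C0norm_ge0 ?invr_ge0//; last first.
      by apply: HG1 => //; rewrite size_mindex_seq.
    rewrite invf_le1 ?ler1n ?ltr0n; apply: prodn_gt0 => j; exact: fact_gt0.
  rewrite powE ?(eqP ak)//; apply: HG2 => //.
  by rewrite size_mindex_seq (eqP ak).
rewrite -EFinD lee_fin; have : (N * G1 * K + N * G2 * K = N * (G1 + G2) * K)%R by ring.
by move=> ->; rewrite ler_wpM2r// lerDl.
Qed.

(** * From the Zygmund norm to dyadic shells *)

Lemma normc_exp (R : realType) (z : R[i]) n : normc (z ^+ n)%R = (normc z ^+ n)%R.
Proof. by elim: n => [|n IH]; rewrite ?expr0 ?normc_one// !exprS normcM IH. Qed.

Lemma monomial_symbol_mindex (R : realType) d k (alpha : mindex d k) m :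
  monomial_symbol R (mindex_seq alpha) m =
  (\prod_j delta_symbol R j m ^+ alpha j)%R.
Proof.
rewrite /monomial_symbol /mindex_seq big_flatten big_map big_enum /=.
by apply: eq_bigr => j _; rewrite big_nseq iter_mulr_1.
Qed.

Definition mindex_pure d k (j : 'I_d) : mindex d k :=
  [ffun i => if i == j then ord_max else ord0].

Lemma mdegree_pure d k (j : 'I_d) : mdegree (mindex_pure k j) = k.
Proof.
rewrite /mdegree (bigD1 j)//= big1 => [|i /negPf ij]; last by rewrite ffunE ij.
by rewrite ffunE eqxx addn0.
Qed.

Lemma normc_monomial_symbol_pure (R : realType) d k (j : 'I_d) m :
  normc (monomial_symbol R (mindex_seq (mindex_pure k j)) m) =
  ((2 * pi * (absz (m ord0 j))%:R) ^+ k)%R.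
Proof.
rewrite monomial_symbol_mindex (bigD1 j)//= [X in (_ * X)%R]big1 => [|i /negPf ij].
  by rewrite ffunE eqxx mulr1 -normc_delta_symbol; exact: normc_exp.
by rewrite ffunE ij expr0.
Qed.

Lemma dyadic_shell_coord d i (m : 'rV[int]_d) : (0 < d)%N -> dyadic_shell i m ->
  exists j, (2 ^ i <= d * absz (m ord0 j))%N.
Proof.
move=> d0 /andP[im _]; apply/existsP; apply: contraLR im.
rewrite negb_exists => /forallP small; rewrite -ltnNge -(ltn_pmul2l d0).
rewrite /znorm1 big_distrr/=.
apply: (@leq_ltn_trans (\sum_(j < d) (2 ^ i).-1)).
  apply: leq_sum => j _; have := small j; rewrite -ltnNge.
  by case: (2 ^ i)%N => //.
by rewrite sum_nat_const card_ord ltn_pmul2l// prednK// expn_gt0.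
Qed.

Lemma le_sum_term (R : realType) (I : finType) (P : pred I) (F : I -> \bar R) i :
  P i -> (forall j, 0 <= F j) -> F i <= \sum_(j | P j) F j.
Proof.
by move=> Pi F0; rewrite (bigD1 i)//= leeDl// sume_ge0.
Qed.

Lemma zygmund_seminorm_ge0 (R : realType) d (eta : R) (A : zmat R d) :
  (0 < d)%N -> 0 <= zygmund_seminorm eta A.
Proof.
move=> d0; apply: le_ereal_sup_tmp.
pose t : 'rV[R]_d := const_mx 1%R.
exists ((rnorm1 t `^ (- eta))%:E * C0norm (chi_diff t (chi_diff t A))); last first.
  by rewrite mule_ge0 ?C0norm_ge0// lee_fin powR_ge0.
exists t => //=; apply/eqP => /rowP /(_ (Ordinal d0)) /eqP.
by rewrite !mxE oner_eq0.
Qed.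

Lemma rnorm1_delta (R : realType) d (j : 'I_d) (h : R) : (0 <= h)%R ->
  rnorm1 (h *: delta_mx ord0 j) = h.
Proof.
move=> h0; rewrite /rnorm1 (bigD1 j)//= big1 => [|i /negPf ij].
  by rewrite !mxE !eqxx mulr1 addr0 ger0_norm.
by rewrite !mxE eqxx ij mulr0 normr0.
Qed.

Lemma hz_dyadic_bound (R : realType) d (k : nat) (eta : R) :
  (0 < d)%N -> (0 < eta)%R ->
  exists2 G : R, (0 < G)%R & forall (H : R) (A : zmat R d),
    Ck k A -> hz_norm k eta A <= H%:E -> dyadic_bound (k%:R + eta) (G * H) A.
Proof.
move=> d0 eta0.
have dR : (0 < d%:R :> R)%R by rewrite ltr0n.
have pi0 : (0 < pi :> R)%R by exact: pi_gt0.
pose theta : R := (pi / (2 * d%:R))%R.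
have theta0 : (0 < theta)%R by rewrite divr_gt0// mulr_gt0.
have theta_pi : (theta <= pi)%R.
  rewrite /theta ler_pdivrMr ?mulr_gt0// ler_peMr ?(ltW pi0)//.
  by rewrite -natrM ler1n muln_gt0.
pose c0 : R := (2 - 2 * cos theta)%R.
have c00 : (0 < c0)%R.
  have : (cos theta < cos 0)%R.
    rewrite ltr_cos// in_itv/= ?lexx ?(ltW pi0)//.
    by rewrite theta_pi (ltW theta0).
  by rewrite cos0 /c0; lra.
pose c1 : R := (c0 * (2 * pi / d%:R) ^+ k)%R.
have c10 : (0 < c1)%R by rewrite mulr_gt0// exprn_gt0// divr_gt0// mulr_gt0.
have G00 : (0 < d%:R / c1)%R by rewrite divr_gt0.
exists (1 + d%:R / c1)%R; first by rewrite addr_gt0.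
move=> H A [AC Apow] AH; have CA : C0 A by rewrite -chi_continuousE.
have powE (alpha : mindex d k) : (mdegree alpha <= k)%N ->
    delta_pow alpha A = multiplier (monomial_symbol R (mindex_seq alpha)) A.
  by move=> /Apow[B AB _]; have [] := delta_powE CA AB.
have Cknorm0 : 0 <= Cknorm k A.
  by apply: sume_ge0 => alpha _; rewrite mule_ge0 ?C0norm_ge0// lee_fin invr_ge0.
have zyg0 : 0 <= \sum_(alpha : mindex d k | mdegree alpha == k)
    zygmund_seminorm eta (delta_pow alpha A).
  by apply: sume_ge0 => alpha _; exact: zygmund_seminorm_ge0.
have AH0 : C0norm A <= H%:E.
  apply: le_trans AH; apply: le_trans (leeDl _ zyg0).
  pose alpha0 : mindex d k := [ffun=> ord0].
  have deg0 : mdegree alpha0 = 0%N by rewrite /mdegree big1// => j _; rewrite ffunE.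
  apply: (@le_trans _ _
      (((mfact alpha0)%:R^-1)%:E * C0norm (delta_pow alpha0 A))); last first.
    apply: (@le_sum_term R _ (fun alpha : mindex d k => (mdegree alpha <= k)%N)
      (fun alpha => ((mfact alpha)%:R^-1)%:E * C0norm (delta_pow alpha A))).
      by rewrite deg0.
    by move=> alpha; rewrite mule_ge0 ?C0norm_ge0// lee_fin invr_ge0.
  rewrite powE ?deg0// /mfact big1 ?invr1 ?mul1e => [|j _]; last first.
    by rewrite ffunE.
  rewrite (size0nil (_ : size (mindex_seq alpha0) = 0%N)) ?size_mindex_seq//.
  rewrite C0norm_multiplier; apply: le_esum => m _.
  by rewrite /monomial_symbol big_nil normc_one mul1e.
have H0 : (0 <= H)%R by rewrite -lee_fin (le_trans (C0norm_ge0 A)).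
have zygH j : zygmund_seminorm eta
    (multiplier (monomial_symbol R (mindex_seq (mindex_pure k j))) A) <= H%:E.
  apply: le_trans AH; apply: le_trans (leeDr _ Cknorm0).
  rewrite -powE ?mdegree_pure//.
  apply: (@le_sum_term R _ (fun alpha : mindex d k => mdegree alpha == k)
    (fun alpha => zygmund_seminorm eta (delta_pow alpha A))).
    by rewrite mdegree_pure.
  by move=> alpha; exact: zygmund_seminorm_ge0.
split.
  apply: (@le_trans _ _ (C0norm A)).
    by apply: esum_ge; exists [set 0%R]; [split|rewrite fsbig_set1].
  apply: le_trans AH0 _; rewrite lee_fin mulrDl mul1r lerDl.
  by rewrite mulr_ge0// ltW.
move=> i; pose h : R := (2 ^- i.+2)%R.
have h0 : (0 < h)%R by rewrite invr_gt0 exprn_gt0.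
pose w (j : 'I_d) (m : 'rV[int]_d) : R :=
  (normc ((expi (2 * pi * zdot m (h *: delta_mx ord0 j)) - 1) *
    (expi (2 * pi * zdot m (h *: delta_mx ord0 j)) - 1) *
    monomial_symbol R (mindex_seq (mindex_pure k j)) m))%R.
have w0 j m : (0 <= w j m)%R by rewrite normc_ge0.
have w_le j : \esum_(m in [set: 'rV[int]_d]) ((w j m)%:E * diag_sup A m) <=
    (h `^ eta * H)%:E.
  have t0 : (h *: delta_mx ord0 j : 'rV[R]_d) != 0%R.
    apply/eqP => /rowP /(_ j) /eqP; rewrite !mxE !eqxx mulr1.
    by rewrite gt_eqF.
  have : (rnorm1 (h *: delta_mx ord0 j : 'rV[R]_d) `^ (- eta))%:E *
     C0norm (chi_diff (h *: delta_mx ord0 j) (chi_diff (h *: delta_mx ord0 j)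
       (multiplier (monomial_symbol R (mindex_seq (mindex_pure k j))) A))) <= H%:E.
    by apply: le_trans (zygH j); apply: ereal_sup_ubound; exists (h *: delta_mx ord0 j)%R.
  rewrite rnorm1_delta ?(ltW h0)// /chi_diff !chi_sub_multiplier !multiplier_comp.
  rewrite C0norm_multiplier => /(lee_wpmul2l (x := (h `^ eta)%:E)) Hh.
  rewrite EFinM; apply: le_trans (Hh _); last by rewrite lee_fin powR_ge0.
  rewrite muleA -EFinM powRN mulfV ?mul1e; last by rewrite gt_eqF// powR_gt0.
  by [].
have shell_le m : dyadic_shell i m ->
    (c1 * (2 ^+ k) ^+ i <= \sum_(j < d) w j m)%R.
  move=> mi; have [j mj] := dyadic_shell_coord d0 mi.
  apply: (@le_trans _ _ (w j m)); last first.
    by rewrite (bigD1 j)//= lerDl sumr_ge0.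
  rewrite /w normcM [normc (_ * _)%R]normcM -expr2 expi_sub1_sqr.
  rewrite normc_monomial_symbol_pure zdot_delta /c1 -mulrA exprAC -exprMn.
  have mjR : (2 ^+ i / d%:R <= (absz (m ord0 j))%:R :> R)%R.
    by rewrite ler_pdivrMr// -natrM -natrX ler_nat mulnC.
  have mjU : ((absz (m ord0 j))%:R <= 2 ^+ i.+1 :> R)%R.
    rewrite -natrX ler_nat; apply: ltnW; case/andP: mi => _; apply: leq_ltn_trans.
    by rewrite /znorm1 (bigD1 j)//= leq_addr.
  have h2 : (h * 2 ^+ i = 4^-1)%R.
    rewrite /h !exprS; field; rewrite expf_neq0//; lra.
  have normE : (`|2 * pi * (h * (m ord0 j)%:~R)| =
      2 * pi * h * (absz (m ord0 j))%:R)%R.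
    rewrite !normrM -intr_norm -abszE -pmulrn !ger0_norm ?(ltW h0) ?pi_ge0//.
    by rewrite !mulrA.
  apply: ler_pM; rewrite ?(ltW c00) ?exprn_ge0//.
  - by rewrite mulr_ge0 ?exprn_ge0// divr_ge0// mulr_ge0// ltW.
  - rewrite /c0 lerD2l lerN2 ler_pM2l//.
    apply: cos_le_between; rewrite ?(ltW theta0)// normE.
      have -> : (theta = 2 * pi * h * (2 ^+ i / d%:R))%R.
        rewrite (_ : _ * _ = 2 * pi * (h * 2 ^+ i) / d%:R)%R; last by ring.
        by rewrite h2 /theta; field; rewrite gt_eqF.
      by rewrite ler_wpM2l// !mulr_ge0// ltW.
    rewrite [leRHS](_ : _ = 2 * pi * h * 2 ^+ i.+1)%R; last first.
      rewrite exprS (_ : _ * (2 * _) = 4 * pi * (h * 2 ^+ i))%R; last by ring.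
      by rewrite h2; field.
    by rewrite ler_wpM2l// !mulr_ge0// ltW.
  - rewrite lerXn2r// ?nnegrE.
    + by rewrite mulr_ge0 ?exprn_ge0// divr_ge0// mulr_ge0// ltW.
    + by rewrite mulr_ge0// mulr_ge0// ltW.
    + rewrite (_ : _ / _ * _ = 2 * pi * (2 ^+ i / d%:R))%R; last by ring.
      by rewrite ler_wpM2l// mulr_ge0// ltW.
set a := \esum_(m in @dyadic_shell d i) diag_sup A m.
have ca : (c1 * (2 ^+ k) ^+ i)%:E * a <= (d%:R * (h `^ eta * H))%:E.
  rewrite -esumZl; last 2 first.
  - by rewrite mulr_ge0 ?exprn_ge0// ltW.
  - exact: diag_sup_ge0.
  apply: (@le_trans _ _ (\esum_(m in [set: 'rV[int]_d])
      \sum_(j < d) ((w j m)%:E * diag_sup A m))).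
    rewrite esum_mkcond; apply: le_esum => m _; case: ifPn => [|_]; last first.
      by apply: sume_ge0 => j _; rewrite mule_ge0 ?diag_sup_ge0// lee_fin.
    rewrite in_setE => mi; rewrite -ge0_sume_distrl; last first.
      by move=> j _; rewrite lee_fin.
    by rewrite lee_wpmul2r ?diag_sup_ge0// sumEFin lee_fin shell_le.
  rewrite esum_sum; last by move=> m j _ _; rewrite mule_ge0 ?diag_sup_ge0// lee_fin.
  apply: (@le_trans _ _ (\sum_(j < d) (h `^ eta * H)%:E)).
    by apply: lee_sum => j _; exact: w_le.
  by rewrite sumEFin big_const iter_addr_0 card_ord mulr_natl.
have cpos : (0 < c1 * (2 ^+ k) ^+ i)%R by rewrite mulr_gt0// !exprn_gt0.
have afin : a <= ((c1 * (2 ^+ k) ^+ i)^-1 * (d%:R * (h `^ eta * H)))%:E.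
  rewrite (_ : a = ((c1 * (2 ^+ k) ^+ i)^-1)%:E * ((c1 * (2 ^+ k) ^+ i)%:E * a)).
    by rewrite [leRHS]EFinM lee_wpmul2l// lee_fin invr_ge0 ltW.
  by rewrite muleA -EFinM mulVf ?mul1e// gt_eqF.
apply: le_trans afin _; rewrite lee_fin.
have heta : (h `^ eta <= (2 `^ (- eta)) ^+ i)%R.
  rewrite /h -powR_invn// -powRrM -powR_mulrn ?powR_ge0// -powRrM.
  apply: ler_powR; first by rewrite ler1n.
  rewrite !mulNr lerN2 [leLHS]mulrC ler_wpM2r ?(ltW eta0)//.
  by rewrite ler_nat -addn2 leq_addr.
rewrite -(powR2N_split k) in heta.
set q := ((2 `^ (- (k%:R + eta))) ^+ i)%R in heta *.
have q0 : (0 <= q)%R by rewrite exprn_ge0// powR_ge0.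
apply: (@le_trans _ _ (d%:R / c1 * H * q)%R); last first.
  by rewrite ler_wpM2r// ler_wpM2r// lerDr.
rewrite ler_pdivrMl//.
rewrite [leRHS](_ : _ = (d%:R * H) * ((2 ^+ k) ^+ i * q))%R; last first.
  by move: (_ ^+ i)%R => y; field; rewrite gt_eqF.
rewrite [leLHS](_ : _ = (d%:R * H) * h `^ eta)%R; last by ring.
by rewrite ler_wpM2l// mulr_ge0.
Qed.

(** * Operator norms of side diagonals *)

#[local] Existing Instance totally_filter.

Lemma l2norm_ge (R : realType) d (x : 'rV[int]_d -> R[i]) k :
  (normc (x k))%:E <= l2norm x.
Proof.
have -> : (normc (x k))%:E = poweR ((normc (x k)) ^+ 2)%:E 2^-1.
  by rewrite poweR_EFin powR12_sqrt ?sqr_ge0// sqrtr_sqr ger0_norm ?normc_ge0.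
rewrite /l2norm gt0_ler_poweR ?invr_ge0// ?in_itv/= ?leey ?andbT.
- by rewrite lee_fin sqr_ge0.
- by apply: esum_ge0 => m _; rewrite lee_fin sqr_ge0.
by apply: esum_ge; exists [set k]; [split|rewrite fsbig_set1].
Qed.

Lemma l2norm_delta (R : realType) d (k : 'rV[int]_d) :
  l2norm (fun l => if l == k then 1%R else 0%R : R[i]) = 1.
Proof.
rewrite /l2norm (esumID [set k]); last by move=> m _; rewrite lee_fin sqr_ge0.
rewrite !setTI esum_set1 ?lee_fin ?sqr_ge0// eqxx normc_one expr1n.
rewrite esum1 ?adde0 ?poweR1r// => m /= /eqP/negPf ->.
by rewrite normc_zero expr0n.
Qed.

Lemma partial_sum_single (R : realType) d (f : 'rV[int]_d -> R[i]) k :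
  (forall l, l != k -> f l = 0%R) ->
  \forall F \near totally, partial_sum f F = f k.
Proof.
move=> f0; exists [fset k]%fset => // F /=; rewrite fsub1set => kF.
rewrite /partial_sum (bigD1 (FSetSub kF))//= big1 ?addr0// => l lk.
by apply: f0; apply: contra_neq lk => lk; apply: val_inj.
Qed.

Lemma l2opnorm_side_diag (R : realType) d (m : 'rV[int]_d) (A : zmat R d) :
  l2opnorm (side_diag m A) = diag_sup A m.
Proof.
have sdE k l : side_diag m A k l = if l == (k - m)%R then A k (k - m)%R else 0%R.
  rewrite /side_diag subr_eq [l == _]eq_sym subr_eq addrC.
  by case: eqP => // ->; rewrite addrK.
apply/eqP; rewrite eq_le; apply/andP; split; last first.
  apply: le_ereal_inf_tmp => _ [c [c0 Hc] <-].
  apply: ge_ereal_sup => _ [k _ <-].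
  pose x l : R[i] := if l == (k - m)%R then 1%R else 0%R.
  have xfin : l2norm x < +oo by rewrite l2norm_delta ltry.
  have [y Axy yx] := Hc x xfin.
  rewrite l2norm_delta mule1 in yx; apply: le_trans yx.
  apply: le_trans (l2norm_ge y k).
  suff -> : A k (k - m)%R = y k by [].
  apply/eqP; rewrite -subr_eq0; apply/eqP/eq0_normc.
  have near1 := @partial_sum_single R d (fun l => side_diag m A k l * x l)%R (k - m)%R.
  have single : \forall F \near totally,
      partial_sum (fun l => side_diag m A k l * x l)%R F = A k (k - m)%R.
    have -> : A k (k - m)%R = (side_diag m A k (k - m) * x (k - m))%R.
      by rewrite sdE /x !eqxx mulr1.
    by apply: near1 => l /negPf lk; rewrite sdE lk mul0r.
  apply/eqP; rewrite eq_le normc_ge0 andbT; apply/ler_addgt0Pl => e e0.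
  rewrite addr0; have /cvgrPdist_lt/(_ e e0) small := Axy k.
  have [F [/= -> ]] := filter_ex (filterI single small).
  by rewrite sub0r normrN => /ltW; apply: le_trans; exact: ler_norm.
have [->|afin] := eqVneq (diag_sup A m) +oo; first exact: leey.
have a_fin : diag_sup A m \is a fin_num.
  by rewrite ge0_fin_numE ?diag_sup_ge0// ltey.
pose c := fine (diag_sup A m).
have c0 : (0 <= c)%R by rewrite fine_ge0// diag_sup_ge0.
apply: ereal_inf_lbound; exists c; last by rewrite fineK.
split=> // x xfin; exists (fun k => A k (k - m) * x (k - m))%R.
  move=> k; apply/cvgrPdist_lt => e e0.
  have single : \forall F \near totally,
      partial_sum (fun l => side_diag m A k l * x l)%R F = (A k (k - m) * x (k - m))%R.
    have -> : (A k (k - m) * x (k - m) = side_diag m A k (k - m) * x (k - m))%R.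
      by rewrite sdE eqxx.
    by apply: partial_sum_single => l /negPf lk; rewrite sdE lk mul0r.
  by apply: filterS single => F ->; rewrite subrr normc_zero subrr normr0.
have c_le k : (normc (A k (k - m)%R) <= c)%R.
  by rewrite -lee_fin fineK//; apply: ereal_sup_ubound; exists k.
have -> : c%:E * l2norm x = poweR ((c ^+ 2)%:E *
    \esum_(k in [set: 'rV[int]_d]) ((normc (x k)) ^+ 2)%:E) 2^-1.
  rewrite poweRM ?lee_fin ?sqr_ge0//; last first.
    by apply: esum_ge0 => k _; rewrite lee_fin sqr_ge0.
  by rewrite poweR_EFin powR12_sqrt ?sqr_ge0// sqrtr_sqr ger0_norm.
have ge0 (z : 'rV[int]_d -> R[i]) :
    0 <= \esum_(k in [set: 'rV[int]_d]) ((normc (z k)) ^+ 2)%:E.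
  by apply: esum_ge0 => k _; rewrite lee_fin sqr_ge0.
rewrite /l2norm gt0_ler_poweR ?invr_ge0// ?in_itv/= ?leey ?andbT//.
  by rewrite mule_ge0// lee_fin sqr_ge0.
have -> : \esum_(k in [set: 'rV[int]_d]) ((normc (x k)) ^+ 2)%:E =
    \esum_(k in [set: 'rV[int]_d]) ((normc (x (k - m)%R)) ^+ 2)%:E.
  apply: (@reindex_esum _ _ _ setT setT (fun k => k - m)%R
    (fun k => ((normc (x k)) ^+ 2)%:E)); split=> //.
    by move=> k l _ _ /addIr.
  by move=> k _; exists (k + m)%R => //; rewrite addrK.
rewrite -esumZl ?sqr_ge0//; last by move=> k; rewrite lee_fin sqr_ge0.
apply: le_esum => k _; rewrite -EFinM lee_fin normcM exprMn.
by rewrite ler_wpM2r ?sqr_ge0// lerXn2r ?nnegrE ?normc_ge0.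
Qed.

Theorem theorem5p19 (R : realType) (d : nat) (hd : (0 < d)%N)
    (r : R) (hr : (0 < r)%R)
    (k : nat) (eta : R) (heta : (0 < eta <= 1)%R) (hrk : r = (k%:R + eta)%R) :
  [/\ @approx_space R d r = @hz_space R d k eta,
      (exists c1 c2 : R, [/\ (0 < c1)%R, (0 < c2)%R &
         forall A : zmat R d, approx_space r A ->
           c1%:E * approx_norm r A <= hz_norm k eta A /\
           hz_norm k eta A <= c2%:E * approx_norm r A]),
      @approx_space R d r =
        [set A : zmat R d | exists C : R,
           l2opnorm (side_diag 0%R A) < +oo /\
           forall j : nat,
             (2 `^ (r * j%:R))%:E *
               (\esum_(l in @dyadic_shell d j) l2opnorm (side_diag l A))
             <= C%:E]
    & forall (A : zmat R d) (j : nat),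
        (2 `^ (r * j%:R))%:E *
          (\esum_(l in @dyadic_shell d j) l2opnorm (side_diag l A)) =
        (2 `^ (r * j%:R))%:E *
          (\esum_(l in @dyadic_shell d j)
             ereal_sup [set (ComplexField.Normc.normc (A m (m - l)%R))%:E
                       | m in [set: 'rV[int]_d]])].
Proof.
have [eta0 _] := andP heta.
have [G1 G10 HG1] := @dyadic_bound_approx R d r hr.
have [G2 G20 HG2] := @dyadic_bound_hz R d k eta heta.
have [G3 G30 HG3] := @hz_dyadic_bound R d k eta hd eta0.
have opsum (A : zmat R d) j :
    \esum_(l in @dyadic_shell d j) l2opnorm (side_diag l A) =
    \esum_(l in @dyadic_shell d j) diag_sup A l.
  by apply: eq_esum => l _; exact: l2opnorm_side_diag.
have approx_ge0 (A : zmat R d) : C0 A -> 0 <= approx_norm r A.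
  move=> CA; apply: le_ereal_sup_tmp; eexists; first by exists 0%N.
  rewrite mule_ge0 ?lee_fin ?powR_ge0// approx_error_tail//.
  by apply: esum_ge0 => m _; exact: diag_sup_ge0.
have approx_dyadic (A : zmat R d) : approx_space r A ->
    approx_norm r A \is a fin_num /\ dyadic_bound r (fine (approx_norm r A)) A.
  move=> [CA Afin]; have fin : approx_norm r A \is a fin_num.
    by rewrite ge0_fin_numE ?approx_ge0.
  by split=> //; apply: approx_dyadic_bound => //; rewrite fineK.
have dyadic_approx (A : zmat R d) K : dyadic_bound r K A -> approx_space r A.
  move=> AK; split; first exact: dyadic_bound_C0 AK.
  exact: le_lt_trans (HG1 _ _ AK) (ltry _).
have hz_fin (A : zmat R d) : hz_space k eta A ->
    hz_norm k eta A \is a fin_num /\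
    dyadic_bound r (G3 * fine (hz_norm k eta A)) A.
  move=> [AC Afin].
  have hz0 : 0 <= hz_norm k eta A.
    apply: adde_ge0; apply: sume_ge0 => alpha _.
      by rewrite mule_ge0 ?C0norm_ge0// lee_fin invr_ge0.
    exact: zygmund_seminorm_ge0.
  have fin : hz_norm k eta A \is a fin_num by rewrite ge0_fin_numE.
  by split=> //; rewrite hrk; apply: HG3 => //; rewrite fineK.
have approx_hz (A : zmat R d) : approx_space r A -> hz_space k eta A.
  move=> /approx_dyadic[_]; rewrite hrk => /HG2[AC AH]; split=> //.
  exact: le_lt_trans AH (ltry _).
split.
- apply/seteqP; split=> A; first exact: approx_hz.
  by move=> /hz_fin[_ /dyadic_approx].
- exists ((G1 * G3)^-1)%R, G2; split=> //; first by rewrite invr_gt0 mulr_gt0.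
  move=> A AA; have [afin aK] := approx_dyadic _ AA.
  have [hfin hK] := hz_fin _ (approx_hz _ AA).
  split; last first.
    rewrite -(fineK afin) -EFinM; rewrite hrk in aK *.
    by have [] := HG2 _ _ aK.
  have := HG1 _ _ hK; rewrite -(fineK afin) -(fineK hfin) -EFinM !lee_fin.
  by rewrite ler_pdivrMl ?mulr_gt0// mulrA.
- apply/seteqP; split=> A.
    move=> /approx_dyadic[_]; set M := fine _ => -[a0 aM]; exists M.
    rewrite l2opnorm_side_diag; split; first exact: le_lt_trans a0 (ltry _).
    move=> j; rewrite opsum powR2_mulrn.
    apply: (@le_trans _ _ (((2 `^ r) ^+ j)%:E * (M * (2 `^ (- r)) ^+ j)%:E)).
      by rewrite lee_wpmul2l// lee_fin exprn_ge0// powR_ge0.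
    by rewrite -EFinM mulrCA powR2N_mul mulr1.
  move=> [C [a0 aC]]; rewrite l2opnorm_side_diag in a0.
  apply: (dyadic_approx A (Num.max C (fine (diag_sup A 0%R)))); split.
    rewrite -[leLHS]fineK ?ge0_fin_numE ?diag_sup_ge0// lee_fin.
    by rewrite le_max lexx orbT.
  move=> i; have := aC i; rewrite opsum powR2_mulrn.
  move=> /(lee_wpmul2l (x := ((2 `^ (- r)) ^+ i)%:E)).
  rewrite lee_fin exprn_ge0 ?powR_ge0// => /(_ isT).
  rewrite muleA -!EFinM mulrC powR2N_mul mul1e => /le_trans; apply.
  by rewrite lee_fin mulrC ler_wpM2r ?exprn_ge0 ?powR_ge0// le_max lexx.
by move=> A j; rewrite opsum.
Qed.
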